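(* Let $G$ be a graph, let $P\subseteq V(G)$, let $r$ be a positive integer, and let $G'$ be the graph obtained by the $r$-neighborhood cliquification on $(G,P)$. Given a tree decomposition $\mathcal{T}$ and a layering $(V_1,V_2,\ldots)$ of $G$ witnessing layered treewidth $k$, it is possible to compute, in time $\mathcal{O}(|\mathcal{T}|\cdot(|V(G)|+|E(G)|))$, a tree decomposition $\mathcal{T}'$ of $G'$ with $|\mathcal{T}'|=|\mathcal{T}|$ and a layering of $G'$ witnessing layered tree-independence number $4rk$. In addition, if $r=1$ and $P$ is an independent set in $G$, the same conclusion holds even if $\mathcal{T}$ and $(V_1,V_2,\ldots)$ (only) witness layered tree-independence number $k$ of $G$.
   Context: All graphs are finite and simple; $\alpha$ denotes the independence number. For $r\ge 0$, $N_G^r[v]$ is the set of vertices at distance at most $r$ from $v$ in $G$ (so it includes $v$). The $r$-neighborhood cliquification on $(G,P)$ yields the graph $H$ with $V(H)=V(G)$ where distinct $u,v$ are adjacent in $H$ iff $uv\in E(G)$ or there exists $p\in P$ with $\{u,v\}\subseteq N_G^r[p]$. A tree decomposition of $G$ is a pair $\mathcal{T}=(T,\{X_t\}_{t\in V(T)})$ with $T$ a tree and bags $X_t\subseteq V(G)$ such that every vertex is in some bag, both endpoints of every edge lie in a common bag, and for each $u\in V(G)$ the nodes $t$ with $u\in X_t$ induce a connected subgraph of $T$; $|\mathcal{T}|=|V(T)|$. A layering of $G$ is an ordered partition $(V_1,V_2,\ldots)$ of $V(G)$ (parts may be empty, all but finitely many are) such that for each edge $uv$ with $u\in V_i$, $v\in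 V_j$ we have $|i-j|\le 1$. A tree decomposition $(T,\{X_t\})$ and a layering $(V_1,V_2,\ldots)$ of a graph witness layered treewidth (resp. layered tree-independence number) $\ell$ if $|X_t\cap V_i|\le\ell$ (resp. $\alpha(G[X_t\cap V_i])\le\ell$) for every bag $X_t$ and layer $V_i$. *)

(* Defs.v *)
From mathcomp Require Import all_boot.

Set Implicit Arguments.
Unset Strict Implicit.
Unset Printing Implicit Defensive.

Record sgraph (V : finType) := SGraph {
  edge : rel V;
  edge_sym : symmetric edge;
  edge_irr : irreflexive edge }.

Section Graphs.
Variable V : finType.
Implicit Types (G : sgraph V) (S P : {set V}).

Definition neighbours G (v : V) : {set V} := [set u | edge G v u].

Definition edge_set G : {set {set V}} :=
  [set [set p.1; p.2] | p : V * V & edge G p.1 p.2].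

Definition independent G S : bool :=
  [forall u in S, forall v in S, ~~ edge G u v].

Definition alpha G : nat := \max_(S : {set V} | independent G S) #|S|.

Fixpoint walk G (l : nat) (u v : V) : bool :=
  if l is l'.+1 then [exists w, edge G u w && walk G l' w v] else u == v.

(* [v] is at distance at most [r] from [p] iff some walk of length at most [r]
   joins them; in particular vertices of other components are excluded. *)
Definition ball G (r : nat) (p : V) : {set V} :=
  [set v | [exists l : 'I_r.+1, walk G l p v]].

Definition connected G : Prop := forall u v : V, connect (edge G) u v.

Definition acyclic G : Prop :=
  forall c : seq V, cycle (edge G) c -> uniq c -> size c < 3.

Definition is_tree G : Prop := [/\ 0 < #|V|, connected G & acyclic G].

Section Induced.
Variables (G : sgraph V) (S : {set V}).

Definition induced_edge : rel {v : V | v \in S} :=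
  fun u v => edge G (val u) (val v).

Fact induced_sym : symmetric induced_edge.
Proof. by move=> u v; apply: edge_sym. Qed.

Fact induced_irr : irreflexive induced_edge.
Proof. by move=> u; apply: edge_irr. Qed.

Definition induced : sgraph {v : V | v \in S} := SGraph induced_sym induced_irr.
End Induced.

Section Cliquification.
Variables (r : nat) (G : sgraph V) (P : {set V}).

Definition cliq_edge : rel V := fun u v =>
  (u != v) &&
  (edge G u v || [exists p in P, [set u; v] \subset ball G r p]).

Fact cliq_sym : symmetric cliq_edge.
Proof.
move=> u v; rewrite /cliq_edge eq_sym edge_sym; congr (_ && (_ || _)).
by apply: eq_existsb => p; rewrite setUC.
Qed.

Fact cliq_irr : irreflexive cliq_edge.
Proof. by move=> u; rewrite /cliq_edge eqxx. Qed.

Definition cliquification : sgraph V := SGraph cliq_sym cliq_irr.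
End Cliquification.

End Graphs.

Definition tree_decomposition (V : finType) (G : sgraph V) (N : finType)
    (T : sgraph N) (X : N -> {set V}) : Prop :=
  [/\ is_tree T,
      forall v, exists t, v \in X t,
      forall u v, edge G u v -> exists t, (u \in X t) && (v \in X t)
    & forall v, connected (induced T [set t | v \in X t])].

(* A layering is given by the index of the layer of each vertex, the first
   layer having index 0; since [V] is finite, all but finitely many layers are
   automatically empty. *)
Definition layer (V : finType) (lay : V -> nat) (i : nat) : {set V} :=
  [set v | lay v == i].

Definition layering (V : finType) (G : sgraph V) (lay : V -> nat) : Prop :=
  forall u v, edge G u v -> (lay u <= (lay v).+1) && (lay v <= (lay u).+1).

Definition witness_layered_tw (V : finType) (G : sgraph V) (N : finType)
    (T : sgraph N) (X : N -> {set V}) (lay : V -> nat) (l : nat) : Prop :=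
  [/\ tree_decomposition G T X, layering G lay
    & forall t i, #|X t :&: layer lay i| <= l].

Definition witness_layered_tin (V : finType) (G : sgraph V) (N : finType)
    (T : sgraph N) (X : N -> {set V}) (lay : V -> nat) (l : nat) : Prop :=
  [/\ tree_decomposition G T X, layering G lay
    & forall t i, alpha (induced G (X t :&: layer lay i)) <= l].

(* The machine: unit-cost RAM programs in structured form, over natural-number
   registers and finitely many arrays.  No operation other than the successor
   returns a value larger than its arguments, so after [c] steps all words are
   bounded by [c] plus the largest word or program constant: the model is a
   weak form of the word RAM with words of logarithmic size, and a running
   time bound here holds in the usual RAM models as well. *)
Record state := State { reg : nat -> nat; arr : nat -> nat -> nat }.

Definition upd (A : Type) (f : nat -> A) (i : nat) (a : A) : nat -> A :=
  fun j => if j == i then a else f j.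

Definition set_reg (s : state) (x v : nat) : state :=
  State (upd (reg s) x v) (arr s).

Definition set_arr (s : state) (a i v : nat) : state :=
  State (reg s) (upd (arr s) a (upd (arr s a) i v)).

Inductive expr :=
  | Const of nat
  | Reg of nat
  | Get of nat & expr
  | Succ of expr
  | Sub of expr & expr
  | Div of expr & expr.

Fixpoint eval (s : state) (e : expr) : nat :=
  match e with
  | Const c => c
  | Reg x => reg s x
  | Get a e1 => arr s a (eval s e1)
  | Succ e1 => (eval s e1).+1
  | Sub e1 e2 => eval s e1 - eval s e2
  | Div e1 e2 => eval s e1 %/ eval s e2
  end.

Fixpoint ecost (e : expr) : nat :=
  match e with
  | Const _ | Reg _ => 1
  | Get _ e1 | Succ e1 => (ecost e1).+1
  | Sub e1 e2 | Div e1 e2 => (ecost e1 + ecost e2).+1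
  end.

Inductive cmd :=
  | Skip
  | Assign of nat & expr
  | Put of nat & expr & expr
  | Seq of cmd & cmd
  | If of expr & cmd & cmd
  | While of expr & cmd.

(* [exec c s n s'] : started in [s], the program [c] halts after [n] steps in
   state [s'].  A test succeeds when its value is nonzero. *)
Inductive exec : cmd -> state -> nat -> state -> Prop :=
  | exec_skip s : exec Skip s 1 s
  | exec_assign x e s :
      exec (Assign x e) s (ecost e).+1 (set_reg s x (eval s e))
  | exec_put a e1 e2 s :
      exec (Put a e1 e2) s (ecost e1 + ecost e2).+1
           (set_arr s a (eval s e1) (eval s e2))
  | exec_seq c1 c2 s1 s2 s3 n1 n2 :
      exec c1 s1 n1 s2 -> exec c2 s2 n2 s3 ->
      exec (Seq c1 c2) s1 (n1 + n2) s3
  | exec_if_true e c1 c2 s s' n :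
      eval s e != 0 -> exec c1 s n s' ->
      exec (If e c1 c2) s (ecost e + n).+1 s'
  | exec_if_false e c1 c2 s s' n :
      eval s e = 0 -> exec c2 s n s' ->
      exec (If e c1 c2) s (ecost e + n).+1 s'
  | exec_while_true e c s1 s2 s3 n1 n2 :
      eval s1 e != 0 -> exec c s1 n1 s2 -> exec (While e c) s2 n2 s3 ->
      exec (While e c) s1 (ecost e + n1 + n2).+1 s3
  | exec_while_false e c s :
      eval s e = 0 -> exec (While e c) s (ecost e).+1 s.

(* A family of sets is stored as consecutive blocks of array [dat], the block
   of index [i] occupying the cells from [off[i]] (included) to [off[i+1]]
   (excluded) and listing the set without repetition, in any order. *)
Definition stores_family (s : state) (off dat m n : nat)
    (F : 'I_m -> {set 'I_n}) : Prop :=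
  forall i : 'I_m,
    arr s off i <= arr s off i.+1 /\
    perm_eq [seq arr s dat j | j <- index_iota (arr s off i) (arr s off i.+1)]
            [seq val x | x <- enum (F i)].

Definition stores_graph (s : state) (x off dat n : nat)
    (G : sgraph 'I_n) : Prop :=
  reg s x = n /\ stores_family s off dat (neighbours G).

(* [G], [P] and [r] are in registers 0, 1 and arrays 0, 1, 2. *)
Definition stores_instance (s : state) (n : nat) (G : sgraph 'I_n)
    (P : {set 'I_n}) (r : nat) : Prop :=
  [/\ stores_graph s 0 0 1 G,
      forall v : 'I_n, arr s 2 v = (v \in P)
    & reg s 1 = r].

(* A tree with bags and a layering are in register 2 and arrays 3 to 7; the
   output of a program is left where its input was. *)
Definition stores_decomposition (s : state) (n m : nat) (T : sgraph 'I_m)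
    (X : 'I_m -> {set 'I_n}) (lay : 'I_n -> nat) : Prop :=
  [/\ stores_graph s 2 3 4 T,
      stores_family s 5 6 X
    & forall v : 'I_n, arr s 7 v = lay v].

(* Started in [s], the program halts within [b] steps and outputs a tree
   decomposition of [H] with [m] nodes and a layering of [H] that witness
   layered tree-independence number [l]. *)
Definition computes_layered_tin (prog : cmd) (s : state) (b n : nat)
    (H : sgraph 'I_n) (m l : nat) : Prop :=
  exists (c : nat) (s' : state) (m' : nat) (T' : sgraph 'I_m')
         (X' : 'I_m' -> {set 'I_n}) (lay' : 'I_n -> nat),
    [/\ exec prog s c s', c <= b, stores_decomposition s' T' X' lay',
        m' = m & witness_layered_tin H T' X' lay' l].

(* Main.v *)
(* For r > 0 the new bag at t consists of X_t and of all v for which some walk of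
   length at most r from v to a vertex of P meets X_t; the new layers are unions of
   2r consecutive layers.  The ball around p in P lies in every new bag whose old
   bag contains p, and the nodes whose new bag contains v form a union of subtrees
   T_x over the connected set of the vertices x on those walks.

   Send each v in a new bag to a vertex x of X_t on its walk, or to itself.  If two
   vertices have the same x, exchanging the tails of their walks puts them into a
   common ball, so the map is injective on independent sets of G'.  Since v and x
   are at most r layers apart, a new layer is sent into 4r old layers.  If r = 1 and
   P is independent, the image of an independent set of G' is independent in G.

   The new bag at t is found in linear time by one breadth-first search from P in two
   copies of G, joined by an arc from the first copy to the second at each vertex of
   X_t: the walks to the second copy of v are those to v that meet X_t. *)

Require Import Defs.
From mathcomp Require Import all_boot.
From mathcomp Require Import zify.

Set Implicit Arguments.
Unset Strict Implicit.
Unset Printing Implicit Defensive.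

(** * The enlarged tree decomposition *)

Section Walks.
Variables (V : finType) (G : sgraph V).

Lemma walk_cat a b u x v : walk G a u x -> walk G b x v -> walk G (a + b) u v.
Proof.
elim: a u => [|a IH] u /=; first by move/eqP->.
case/existsP=> w /andP[uw wx] xv; apply/existsP; exists w.
by rewrite uw (IH w).
Qed.

Lemma walk_sym l u v : walk G l u v -> walk G l v u.
Proof.
elim: l u => [|l IH] u /=; first by rewrite eq_sym.
case/existsP=> w /andP[uw /IH vw]; have wu: walk G 1 w u.
  by apply/existsP; exists u; rewrite edge_sym uw /=.
by have := walk_cat vw wu; rewrite addn1.
Qed.

Lemma ballP r p v : reflect (exists2 l, l <= r & walk G l p v) (v \in ball G r p).
Proof.
rewrite inE; apply: (iffP existsP) => [[l w]|[l le_lr w]]; first by exists l; rewrite // -ltnS.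
by exists (Ordinal (le_lr : l < r.+1)).
Qed.

Lemma walk_lay lay l u v : layering G lay -> walk G l u v -> lay u <= lay v + l.
Proof.
move=> layG; elim: l u => [|l IH] u /=; first by move/eqP->; rewrite addn0.
case/existsP=> w /andP[/layG/andP[uw _] /IH wv].
by rewrite addnS (leq_trans uw).
Qed.
End Walks.

Section Connectivity.
Variables (N : finType) (T : sgraph N).

(** A relation on all of [N], so that paths inside different sets of nodes can be compared and
    concatenated without passing between the subtypes of [induced]. *)
Definition edge_in (S : {set N}) : rel N :=
  fun a b => [&& a \in S, b \in S & edge T a b].

Lemma edge_in_sub (S1 S2 : {set N}) : S1 \subset S2 ->
  subrel (connect (edge_in S1)) (connect (edge_in S2)).
Proof.
move=> /subsetP sub12; apply: connect_sub => a b /and3P[aS bS ab].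
by apply: connect1; rewrite /edge_in !sub12.
Qed.

Lemma edge_in_sym S : connect_sym (edge_in S).
Proof.
by apply: sym_connect_sym => a b; rewrite /edge_in edge_sym; case: (a \in S); case: (b \in S).
Qed.

Lemma induced_connectedP (S : {set N}) :
  connected (induced T S) <-> {in S &, forall a b, connect (edge_in S) a b}.
Proof.
split=> [conS a b aS bS | conS u v].
  have /connectP[c] := conS (Sub a aS) (Sub b bS).
  rewrite -[a in connect _ a _](SubK {x | x \in S} aS).
  rewrite -[b in connect _ _ b](SubK {x | x \in S} bS).
  elim: c (Sub a aS : {x | x \in S}) => [|y c IH] x /=; first by move=> _ <-.
  case/andP=> xy pc /(IH _ pc); apply: connect_trans; apply: connect1.
  by apply/and3P; split; [exact: (valP x) | exact: (valP y) |].
have /connectP[c] := conS _ _ (valP u) (valP v).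
elim: c u => [|y c IH] u /=; first by move=> _ /val_inj->; rewrite connect0.
case/andP=> /and3P[uS yS uy] pc ev.
by apply: connect_trans (IH (Sub y yS) pc ev); apply: connect1.
Qed.
End Connectivity.

(** Images and preimages under the injection [val] preserve independence and cardinality; this
    removes the subtype from all later bounds. *)
Lemma alpha_inducedP (V : finType) (G : sgraph V) (S : {set V}) k :
  reflect (forall A : {set V}, A \subset S -> independent G A -> #|A| <= k)
          (alpha (induced G S) <= k).
Proof.
apply: (iffP idP) => [le_k A subAS indA | le_k].
  pose B : {set {v | v \in S}} := [set u | val u \in A].
  have <-: #|B| = #|A|.
    rewrite -(card_imset (mem B) val_inj); apply: eq_card => x.
    apply/imsetP/idP => [[u]|xA]; first by rewrite inE => uA ->.
    by exists (Sub x (subsetP subAS x xA)); rewrite ?inE ?SubK.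
  apply: leq_trans le_k; apply: (bigmax_sup B) => //.
  apply/forall_inP => u; rewrite inE => uA; apply/forall_inP => v; rewrite inE => vA.
  exact: (forall_inP (forall_inP indA _ uA) _ vA).
apply/bigmax_leqP => B indB; rewrite -(card_imset (mem B) val_inj).
apply: le_k; first by apply/subsetP => _ /imsetP[u _ ->]; apply: valP.
apply/forall_inP => _ /imsetP[u uB ->]; apply/forall_inP => _ /imsetP[v vB ->].
exact: (forall_inP (forall_inP indB _ uB) _ vB).
Qed.

Section Enlarge.
Variables (V N : finType) (G : sgraph V) (P : {set V}) (r : nat) (T : sgraph N).
Variables (X : N -> {set V}) (lay : V -> nat).

(** A walk of length at most [r] from [v] to [P], cut at its vertex [x]: [b] is the length of the
    part next to [v], and the ball bounds the rest. The range of [b] makes this a boolean. *)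
Definition passes (x v : V) : bool :=
  [exists b : 'I_r.+1, walk G b v x && [exists p in P, x \in ball G (r - b) p]].

Lemma passesP x v :
  reflect (exists a b p, [/\ a + b <= r, walk G b v x, p \in P & walk G a p x])
          (passes x v).
Proof.
apply: (iffP existsP) => [[b /andP[vx /exists_inP[p pP /ballP[a le_a px]]]]|].
  by exists a, b, p; split=> //; have := ltn_ord b; lia.
case=> a [b [p [le_r vx pP px]]]; have lt_b: b < r.+1 by lia.
exists (Ordinal lt_b); rewrite /= vx; apply/exists_inP; exists p => //.
by apply/ballP; exists a => //; lia.
Qed.

Definition enlarge (t : N) : {set V} :=
  X t :|: [set v | [exists x in X t, passes x v]].

(* Dividing twice, because the machine cannot form [2 * r]. *)
Definition coarsen (v : V) : nat := lay v %/ r %/ 2.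

Lemma enlargeP t v :
  reflect (v \in X t \/ exists2 x, x \in X t & passes x v) (v \in enlarge t).
Proof.
rewrite !inE; apply: (iffP orP) => [[|/exists_inP]|[|/exists_inP]]; by [left|right].
Qed.

Lemma enlarge_tree_decomposition :
  tree_decomposition G T X -> tree_decomposition (cliquification r G P) T enlarge.
Proof.
case=> treeT covV covE conX; split=> //.
- by move=> v; have [t vt] := covV v; exists t; apply/enlargeP; left.
- move=> u v /andP[_ /orP[/covE[t /andP[ut vt]]|]].
    by exists t; apply/andP; split; apply/enlargeP; left.
  case/exists_inP=> p pP; rewrite subUset !sub1set => /andP[/ballP[a le_a pu] /ballP[b le_b pv]].
  (* Any bag containing [p] will do: a walk from a vertex of the ball to [p] passes [p] at its end,
     so the part from [p] to [x] is empty. *)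
  have [t pt] := covV p; exists t; apply/andP; split; apply/enlargeP; right; exists p => //;
    apply/passesP; [exists 0, a, p | exists 0, b, p]; rewrite add0n /= eqxx pP; split=> //;
    exact: walk_sym.
move=> v; apply/induced_connectedP.
set S := [set t | v \in enlarge t].
have conXv w t t' : [set t | w \in X t] \subset S -> w \in X t -> w \in X t' ->
    connect (edge_in T S) t t'.
  move=> sub wt wt'; apply: (edge_in_sub sub).
  by move/induced_connectedP: (conX w); apply; rewrite inE.
have subv : [set t | v \in X t] \subset S.
  by apply/subsetP => t; rewrite !inE => ->.
have [t0 vt0] := covV v.
have toT0 t : t \in S -> connect (edge_in T S) t t0.
  rewrite inE => /enlargeP[vt|[x xt]]; first exact: conXv vt vt0.
  case/passesP=> a [b [p [le_r /walk_sym xv pP px]]].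
  (* Induction along the walk from [x] to [v], with [a + b] constant. The subtree of [x] lies in
     [S], and it meets the subtree of the next vertex [w] at a node whose bag covers the edge
     [xw]. *)
  elim: b a x t xt le_r xv px => [|b IH] a x t xt le_r.
    by move=> /= /eqP exv _; move: xt; rewrite exv => vt; apply: conXv vt vt0.
  move=> xv px; have subx : [set t | x \in X t] \subset S.
    apply/subsetP => t'; rewrite !inE => xt'; apply/orP; right.
    apply/exists_inP; exists x => //; apply/passesP.
    by exists a, b.+1, p; split=> //; apply: walk_sym.
  move: xv => /= /existsP[w /andP[xw wv]].
  have [t1 /andP[xt1 wt1]] := covE _ _ xw.
  apply: connect_trans (conXv x t t1 subx xt xt1) _.
  apply: (IH a.+1 w t1 wt1 _ wv); first by lia.
  by rewrite -addn1; apply: (walk_cat px); apply/existsP; exists w; rewrite xw /= eqxx.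
by move=> t t' /toT0 h /toT0 h'; apply: connect_trans h _; rewrite edge_in_sym.
Qed.

Lemma coarsenE v : coarsen v = lay v %/ r.*2.
Proof. by rewrite /coarsen -divnMA muln2. Qed.

(** Two vertices in the ball of [p] are each within [r] layers of [p], hence within [2r] layers of
    each other, and division by [2r] leaves a difference of at most one. *)
Lemma coarsen_layering : 0 < r -> layering G lay ->
  layering (cliquification r G P) coarsen.
Proof.
move=> r_gt0 layG u v uv; rewrite !coarsenE.
have near : lay u <= lay v + r.*2 /\ lay v <= lay u + r.*2.
  case/andP: uv => _ /orP[/layG|]; first by lia.
  case/exists_inP=> p pP; rewrite subUset !sub1set.
  case/andP=> /ballP[a le_a pu] /ballP[b le_b pv].
  have := walk_lay layG pu; have := walk_lay layG (walk_sym pu).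
  by have := walk_lay layG pv; have := walk_lay layG (walk_sym pv); lia.
have le_div (a b : nat) : a <= b + r.*2 -> a %/ r.*2 <= (b %/ r.*2).+1.
  move=> le_ab; apply: leq_trans (leq_div2r _ le_ab) _.
  by rewrite divnDr // divnn double_gt0 r_gt0 addn1.
by rewrite !le_div //; case: near.
Qed.

(** * Independent sets of the cliquification inside the new bags *)

Lemma card_layers_le (A : {set V}) lo w k :
  (forall x, x \in A -> lo <= lay x + r < lo + w) ->
  (forall i, #|A :&: layer lay i| <= k) -> #|A| <= w * k.
Proof.
move=> inA le_k; pose C (j : 'I_w) := A :&: [set x | lay x + r == lo + j].
have -> : A = \bigcup_j C j.
  apply/setP=> x; apply/idP/bigcupP => [xA|[j _]]; last by case/setIP.
  have /andP[le_lo lt_w] := inA x xA.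
  have lt_j : lay x + r - lo < w by lia.
  by exists (Ordinal lt_j); rewrite // !inE xA /=; apply/eqP; lia.
apply: leq_trans (_ : \sum_(j < w) k <= _); last by rewrite sum_nat_const card_ord.
apply: (@leq_trans (\sum_j #|C j|)).
  by elim/big_ind2: _ => [|B1 n1 B2 n2 h1 h2|//]; rewrite ?cards0 //;
     apply: leq_trans (leq_card_setU _ _) (leq_add h1 h2).
(* If [lo + j < r], the subtraction is truncated, but then [C j] is empty. *)
apply: leq_sum => j _; apply: leq_trans (le_k (lo + j - r)).
by apply: subset_leq_card; apply/subsetP => x; rewrite !inE => /andP[-> /eqP e] /=; apply/eqP; lia.
Qed.

(** Within the new bag, the default [v] is taken only by vertices of [X t], so the value always lies
    in [X t]. *)
Definition anchor (t : N) (v : V) : V := odflt v [pick x in X t | passes x v].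

Lemma anchorP t v : v \in enlarge t ->
  (anchor t v \in X t) /\ (passes (anchor t v) v \/ anchor t v = v).
Proof.
rewrite /anchor => /enlargeP; case: pickP => [x /andP[xt pass] _|none] /=.
  by split=> //; left.
by case=> [vt|[x xt pass]]; [split=> //; right | have := none x; rewrite /= xt pass].
Qed.

(* Of two walks through a common [x], the shorter tail from [x] can replace the longer
   one, so both vertices are in the ball of the same element of [P]. *)
Lemma passes_common x v w : passes x v -> passes x w ->
  exists2 p, p \in P & (v \in ball G r p) && (w \in ball G r p).
Proof.
move=> /passesP[a [b [p [le_ab vx pP px]]]] /passesP[c [d [q [le_cd wx qP qx]]]].
case: (leqP b d) => cmp.
  exists q => //; apply/andP; split; apply/ballP.
    by exists (c + b); [lia | apply: (walk_cat qx); apply: walk_sym].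
  by exists (c + d) => //; apply: (walk_cat qx); apply: walk_sym.
exists p => //; apply/andP; split; apply/ballP.
  by exists (a + b) => //; apply: (walk_cat px); apply: walk_sym.
by exists (a + d); [lia | apply: (walk_cat px); apply: walk_sym].
Qed.

Lemma passes_ball x v : passes x v ->
  exists2 p, p \in P & (v \in ball G r p) && (x \in ball G r p).
Proof.
case/passesP=> a [b [p [le_r vx pP px]]]; exists p => //.
apply/andP; split; apply/ballP; last by exists a => //; lia.
by exists (a + b) => //; apply: (walk_cat px); apply: walk_sym.
Qed.

Lemma cliq_ball u v p : p \in P -> (u \in ball G r p) && (v \in ball G r p) ->
  u != v -> edge (cliquification r G P) u v.
Proof.
move=> pP uvp neq; rewrite /= /cliq_edge neq /=; apply/orP; right.
by apply/exists_inP; exists p => //; rewrite subUset !sub1set.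
Qed.

Lemma anchor_inj t (A : {set V}) : A \subset enlarge t ->
  independent (cliquification r G P) A -> {in A &, injective (anchor t)}.
Proof.
move=> /subsetP subA indA v w vA wA eq_vw; apply/eqP/idPn => neq.
have /negP[] := forall_inP (forall_inP indA _ vA) _ wA.
have [_] := anchorP (subA _ vA); have [_] := anchorP (subA _ wA); rewrite -eq_vw.
(* In the mixed cases the common anchor is one of the two vertices, which therefore lies on the walk
   of the other one and in the same ball. *)
case=> [pw|ew] [pv|ev].
- by have [p pP vwp] := passes_common pv pw; apply: cliq_ball vwp neq.
- have [p pP] := passes_ball pw; rewrite ev andbC => vwp.
  by apply: cliq_ball vwp neq.
- by have [p pP] := passes_ball pv; rewrite ew => vwp; apply: cliq_ball vwp neq.
by rewrite -ev ew eqxx in neq.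
Qed.

Lemma anchor_lay t v : layering G lay -> v \in enlarge t ->
  lay (anchor t v) <= lay v + r /\ lay v <= lay (anchor t v) + r.
Proof.
move=> layG /anchorP[_ [/passesP[a [b [p [le_r vx _ _]]]]|->]]; last by lia.
by have := walk_lay layG vx; have := walk_lay layG (walk_sym vx); lia.
Qed.

(* A layer of [coarsen] consists of [2r] layers of [lay], and the anchors of
   its vertices lie in these and in the [r] layers on either side. *)
Lemma alpha_enlarge_le t i k : 0 < r -> layering G lay ->
  (forall (A : {set V}) j, A \subset enlarge t -> independent (cliquification r G P) A ->
     #|anchor t @: A :&: layer lay j| <= k) ->
  alpha (induced (cliquification r G P) (enlarge t :&: layer coarsen i)) <= 4 * r * k.
Proof.
move=> r_gt0 layG le_k; apply/alpha_inducedP => A; rewrite subsetI => /andP[subA sublay] indA.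
rewrite -(card_in_imset (anchor_inj subA indA)).
apply: (@card_layers_le _ (i * r.*2)) => [_ /imsetP[v vA ->]|j]; last exact: le_k.
have [] := anchor_lay layG (subsetP subA _ vA).
have := subsetP sublay _ vA; rewrite inE coarsenE => /eqP <-.
have := divn_eq (lay v) r.*2; have := @ltn_pmod (lay v) r.*2; rewrite double_gt0 => /(_ r_gt0).
by move: (_ %/ _ * _) (_ %% _) => q d; lia.
Qed.

Lemma witness_enlarge_tw k : 0 < r -> witness_layered_tw G T X lay k ->
  witness_layered_tin (cliquification r G P) T enlarge coarsen (4 * r * k).
Proof.
move=> r_gt0 [decX layG le_k]; split.
- exact: enlarge_tree_decomposition.
- exact: coarsen_layering.
move=> t i; apply: alpha_enlarge_le => // A j /subsetP subA indA; apply: leq_trans (le_k t j).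
apply/subset_leq_card/setSI/subsetP => _ /imsetP[v vA ->].
by have [] := anchorP (subA v vA).
Qed.

(** Here the old bags bound only independent sets, so the set of anchors must itself be independent
    in [G]. Each anchor is the vertex itself or an element of [P] adjacent to it, which leaves three
    kinds of pairs to check. *)
Lemma witness_enlarge_tin k : r = 1 -> independent G P -> witness_layered_tin G T X lay k ->
  witness_layered_tin (cliquification r G P) T enlarge coarsen (4 * r * k).
Proof.
move=> r1 indP [decX layG le_k].
have r_gt0: 0 < r by rewrite r1.
split.
- exact: enlarge_tree_decomposition.
- exact: coarsen_layering.
move=> t i; apply: alpha_enlarge_le => // A j /subsetP subA indA.
apply: (alpha_inducedP _ _ _ (le_k t j)).
  by apply/setSI/subsetP => _ /imsetP[v vA ->]; have [] := anchorP (subA v vA).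
(* From [a + b <= 1]: either [b = 0] and the anchor is [v], or [b = 1] and [a = 0], so that the
   anchor is the end of the walk in [P]. *)
have anchorE v : v \in A -> anchor t v = v \/ anchor t v \in P /\ edge G (anchor t v) v.
  move=> vA; have [_ [|]] := anchorP (subA v vA); last by left.
  case/passesP=> a [[|b] [p [le_r vx pP px]]]; first by left; apply/esym/eqP.
  have [? ?]: b = 0 /\ a = 0 by lia.
  subst a b; move/eqP: px => px; right; split; first by rewrite -px.
  by case/existsP: vx => w /andP[vw /eqP <-]; rewrite edge_sym.
apply/forall_inP => _ /setIP[/imsetP[v vA ->] _]; apply/forall_inP => _ /setIP[/imsetP[w wA ->] _].
have nadj u u' : u \in A -> u' \in A -> ~~ edge (cliquification r G P) u u'.
  by move=> uA u'A; apply: (forall_inP (forall_inP indA _ uA) _ u'A).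
have nadjG u u' : u \in A -> u' \in A -> ~~ edge G u u'.
  move=> uA u'A; apply: contra (nadj _ _ uA u'A) => uu'.
  by rewrite /= /cliq_edge uu' andbT; apply: contraTneq uu' => ->; rewrite edge_irr.
(* An edge from [u] to the anchor of [u'] would put both [u] and [u'] into the ball around that
   anchor, making them adjacent in the cliquification. *)
have mixed u u' : u \in A -> u' \in A -> anchor t u = u -> anchor t u' \in P ->
    edge G (anchor t u') u' -> ~~ edge G u (anchor t u').
  move=> uA u'A eu pP pu'; apply/negP => up.
  have /negP[] := nadj u u' uA u'A; apply: cliq_ball pP _ _.
    rewrite r1; apply/andP; split; apply/ballP; exists 1 => //; apply/existsP;
      [exists u | exists u']; by rewrite /= eqxx andbT // edge_sym.
  by apply: contraTneq up => e; rewrite -e eu edge_irr.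
case: (anchorE v vA) => [ev|[vP pv]]; case: (anchorE w wA) => [ew|[wP pw]].
- by rewrite ev ew nadjG.
- by rewrite [in X in edge _ X _]ev mixed.
- by rewrite [in X in edge _ _ X]ew edge_sym mixed.
by apply: (forall_inP (forall_inP indP _ vP) _ wP).
Qed.
End Enlarge.

(** * Running time of programs *)

(** A total function, at the price of a meaningless value on loops; it is applied to [loopfree]
    programs only, as is [ccost]. *)
Fixpoint sem (c : cmd) (s : state) : state :=
  match c with
  | Skip | While _ _ => s
  | Assign x e => set_reg s x (eval s e)
  | Put a e1 e2 => set_arr s a (eval s e1) (eval s e2)
  | Seq c1 c2 => sem c2 (sem c1 s)
  | If e c1 c2 => if eval s e is 0 then sem c2 s else sem c1 s
  end.

Fixpoint loopfree (c : cmd) : bool :=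
  match c with
  | While _ _ => false
  | Seq c1 c2 | If _ c1 c2 => loopfree c1 && loopfree c2
  | _ => true
  end.

Fixpoint ccost (c : cmd) : nat :=
  match c with
  | Skip | While _ _ => 1
  | Assign _ e => (ecost e).+1
  | Put _ e1 e2 => (ecost e1 + ecost e2).+1
  | Seq c1 c2 => ccost c1 + ccost c2
  | If e c1 c2 => (ecost e + maxn (ccost c1) (ccost c2)).+1
  end.

Fixpoint wregs (c : cmd) : seq nat :=
  match c with
  | Skip | Put _ _ _ => [::]
  | Assign x _ => [:: x]
  | Seq c1 c2 | If _ c1 c2 => wregs c1 ++ wregs c2
  | While _ c1 => wregs c1
  end.

Fixpoint warrs (c : cmd) : seq nat :=
  match c with
  | Skip | Assign _ _ => [::]
  | Put a _ _ => [:: a]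
  | Seq c1 c2 | If _ c1 c2 => warrs c1 ++ warrs c2
  | While _ c1 => warrs c1
  end.

(** The criterion is syntactic, and an array counts as written as a whole. *)
Definition frame (c : cmd) (s s' : state) : Prop :=
  (forall x, x \notin wregs c -> reg s' x = reg s x) /\
  (forall a, a \notin warrs c -> arr s' a = arr s a).

(** A total correctness triple with a time bound. The initial state is explicit, so [Q] can refer to
    values before the run. *)
Definition runs (c : cmd) (s : state) (b : nat) (Q : state -> Prop) : Prop :=
  exists n s', [/\ exec c s n s', n <= b & Q s'].

Lemma frame_trans c s1 s2 s3 : frame c s1 s2 -> frame c s2 s3 -> frame c s1 s3.
Proof.
by case=> r12 a12 [r23 a23]; split=> x xc; rewrite ?r23 ?a23 ?r12 ?a12.
Qed.

Lemma frame_sub c1 c2 s s' :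
  {subset wregs c1 <= wregs c2} -> {subset warrs c1 <= warrs c2} ->
  frame c1 s s' -> frame c2 s s'.
Proof.
by move=> subr suba [fr fa]; split=> x xc; rewrite ?fr ?fa //;
  apply: contra xc; [apply: subr | apply: suba].
Qed.

Lemma exec_frame c s n s' : exec c s n s' -> frame c s s'.
Proof.
elim=> {c s n s'} //=.
- move=> x e s; split=> // y /=; rewrite inE => yx.
  by rewrite /upd (negPf yx).
- move=> a e1 e2 s; split=> // y /=; rewrite inE => yx.
  by rewrite /upd (negPf yx).
- move=> c1 c2 s1 s2 s3 n1 n2 _ f1 _ f2; apply: (@frame_trans _ _ s2).
    by apply: frame_sub f1 => x /=; rewrite mem_cat => ->.
  by apply: frame_sub f2 => x /=; rewrite mem_cat orbC => ->.
- by move=> e c1 c2 s s' n _ _; apply: frame_sub => x /=; rewrite mem_cat => ->.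
- by move=> e c1 c2 s s' n _ _; apply: frame_sub => x /=; rewrite mem_cat orbC => ->.
by move=> e c s1 s2 s3 n1 n2 _ _ f1 _; apply: frame_trans.
Qed.

Lemma runs_frame c s b Q :
  runs c s b Q -> runs c s b (fun s' => frame c s s' /\ Q s').
Proof.
by case=> n [s' [ex le Qs]]; exists n, s'; split=> //; split=> //; apply: exec_frame ex.
Qed.

(** The rule of consequence. The frame comes for free, so specifications need not list what a
    program leaves unchanged. *)
Lemma runs_weaken c s b b' (Q Q' : state -> Prop) :
  runs c s b Q -> b <= b' -> (forall s', frame c s s' -> Q s' -> Q' s') -> runs c s b' Q'.
Proof.
move=> /runs_frame[n [s' [ex le [fr Qs]]]] le_b QQ'.
by exists n, s'; split=> //; [apply: leq_trans le_b | apply: QQ'].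
Qed.

Lemma runs_seq c1 c2 s b1 b2 Q :
  runs c1 s b1 (fun s' => runs c2 s' b2 Q) -> runs (Seq c1 c2) s (b1 + b2) Q.
Proof.
case=> n1 [s1 [ex1 le1 [n2 [s2 [ex2 le2 Qs]]]]].
by exists (n1 + n2), s2; split; [apply: exec_seq ex1 ex2 | apply: leq_add | ].
Qed.

Lemma runs_if e c1 c2 s b Q :
  (eval s e != 0 -> runs c1 s b Q) -> (eval s e = 0 -> runs c2 s b Q) ->
  runs (If e c1 c2) s (ecost e + b).+1 Q.
Proof.
move=> run1 run2; have [e0|e0] := eqVneq (eval s e) 0.
  have [n [s' [ex le Qs]]] := run2 e0; exists (ecost e + n).+1, s'; split=> //.
    exact: exec_if_false.
  by rewrite ltnS leq_add2l.
have [n [s' [ex le Qs]]] := run1 e0; exists (ecost e + n).+1, s'; split=> //.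
  exact: exec_if_true.
by rewrite ltnS leq_add2l.
Qed.

Lemma runs_loopfree c s (Q : state -> Prop) :
  loopfree c -> Q (sem c s) -> runs c s (ccost c) Q.
Proof.
elim: c s Q => //=.
- by move=> s Q _ Qs; exists 1, s; split=> //; apply: exec_skip.
- by move=> x e s Q _ Qs; do 2!eexists; split; [apply: exec_assign | | ].
- by move=> a e1 e2 s Q _ Qs; do 2!eexists; split; [apply: exec_put | | ].
- move=> c1 IH1 c2 IH2 s Q /andP[lf1 lf2] Qs.
  by apply: runs_seq; apply: IH1 => //; apply: IH2.
move=> e c1 IH1 c2 IH2 s Q /andP[lf1 lf2] Qs.
apply: runs_if => e0; [apply: (runs_weaken (IH1 s Q lf1 _)) | apply: (runs_weaken (IH2 s Q lf2 _))];
  rewrite ?leq_maxl ?leq_maxr //; last by rewrite e0 in Qs.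
by case: (eval s e) e0 Qs.
Qed.

Lemma runs_loopfree_le c s b (Q : state -> Prop) :
  loopfree c -> ccost c <= b -> Q (sem c s) -> runs c s b Q.
Proof. by move=> lf le_b Qs; apply: runs_weaken (runs_loopfree lf Qs) le_b _. Qed.

(* [phi] is a potential: it pays for the remaining iterations. *)
Lemma runs_while e c (I : state -> Prop) (phi cost : state -> nat) s :
  (forall s, I s -> eval s e != 0 ->
     runs c s (cost s) (fun s' => I s' /\ phi s' + cost s + (ecost e).+1 <= phi s)) ->
  I s ->
  runs (While e c) s (phi s + (ecost e).+1) (fun s' => I s' /\ eval s' e = 0).
Proof.
(* Induction on a bound for the potential, which strictly decreases because each test already costs
   a step. *)
move=> body; move: {2}(phi s) (leqnn (phi s)) => m.
elim: m s => [|m IH] s le_m Is; have [e0|e0] := eqVneq (eval s e) 0.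
- by exists (ecost e).+1, s; split=> //; [apply: exec_while_false | rewrite leq_addl].
- by have [n [s' [_ _ [_]]]] := body s Is e0; lia.
- by exists (ecost e).+1, s; split=> //; [apply: exec_while_false | rewrite leq_addl].
have [n1 [s1 [ex1 le1 [Is1 dec]]]] := body s Is e0.
have [|n2 [s2 [ex2 le2 Qs2]]] := IH s1 _ Is1; first by lia.
exists (ecost e + n1 + n2).+1, s2; split=> //; last by lia.
exact: exec_while_true ex1 ex2.
Qed.

(** A counting loop whose counter is already set. Subtraction being truncated, the test says that
    [i] is below [e]; as [e] is evaluated anew each time, its value must be stable under the
    frame. *)
Definition Resume (i : nat) (e : expr) (c : cmd) : cmd :=
  While (Defs.Sub e (Reg i)) (Seq c (Assign i (Succ (Reg i)))).

Lemma runs_resume i e c (I : nat -> state -> Prop) b s lo hi :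
  i \notin wregs c -> reg s i = lo -> lo <= hi ->
  (forall s', frame (Resume i e c) s s' -> eval s' e = hi) -> I lo s ->
  (forall k s', lo <= k < hi -> frame (Resume i e c) s s' -> reg s' i = k -> I k s' ->
     runs c s' b (fun s'' => I k.+1 (set_reg s'' i k.+1))) ->
  runs (Resume i e c) s ((hi - lo) * (b + ecost e + 6) + ecost e + 3)
    (fun s' => I hi s' /\ reg s' i = hi).
Proof.
move=> ic slo le_lh ehi Ilo body.
pose J s' := [/\ frame (Resume i e c) s s', lo <= reg s' i <= hi & I (reg s' i) s'].
(* One iteration costs [b] for the body, 3 for the increment and [ecost e + 3] for the test. *)
pose phi s' := (hi - reg s' i) * (b + ecost e + 6).
have step s' : J s' -> eval s' (Defs.Sub e (Reg i)) != 0 ->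
    runs (Seq c (Assign i (Succ (Reg i)))) s' (b + 3)
      (fun s'' => J s'' /\ phi s'' + (b + 3) + (ecost (Defs.Sub e (Reg i))).+1 <= phi s').
  case=> fr /andP[le_lo le_hi] Ik /=; rewrite (ehi _ fr) => lt_hi.
  have lt_k : lo <= reg s' i < hi by lia.
  apply: runs_seq.
  apply: (runs_weaken (body _ _ lt_k fr erefl Ik)) => // s1 fr1 I1.
  apply: (runs_weaken (@runs_loopfree (Assign i (Succ (Reg i))) _ (fun s2 => s2 = _) isT erefl))
    => //= s2 fr2 ->.
  have e1 : reg s1 i = reg s' i by case: fr1 => ->.
  have e2 : reg (set_reg s1 i (reg s1 i).+1) i = (reg s' i).+1.
    by rewrite /= /upd eqxx e1.
  split; last first.
    rewrite /phi e2; have -> : hi - reg s' i = (hi - (reg s' i).+1).+1 by lia.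
    by rewrite mulSn; lia.
  split; rewrite ?e2 ?e1 //; last by lia.
  apply: (frame_trans fr); apply: (@frame_trans _ _ s1).
    by apply: frame_sub fr1 => x /=; rewrite ?cats0 // mem_cat => ->.
  split=> x //=; rewrite mem_cat inE negb_or => /andP[_ xi].
  by rewrite /upd (negPf xi).
have J0 : J s by split; rewrite ?slo //; lia.
have := runs_while step J0; rewrite /phi slo => run.
apply: (runs_weaken run); first by rewrite /=; lia.
move=> s' _ [[fr le_k Ik] /=]; rewrite (ehi _ fr) => e0.
have e1 : reg s' i = hi by lia.
by split=> //; rewrite -e1.
Qed.

Definition For (i : nat) (e0 e : expr) (c : cmd) : cmd :=
  Seq (Assign i e0) (Resume i e c).

Lemma runs_for i e0 e c (I : nat -> state -> Prop) b s lo hi :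
  i \notin wregs c -> eval s e0 = lo -> lo <= hi ->
  (forall s', frame (For i e0 e c) s s' -> eval s' e = hi) -> I lo (set_reg s i lo) ->
  (forall k s', lo <= k < hi -> frame (For i e0 e c) s s' -> reg s' i = k -> I k s' ->
     runs c s' b (fun s'' => I k.+1 (set_reg s'' i k.+1))) ->
  runs (For i e0 e c) s ((hi - lo) * (b + ecost e + 6) + (ecost e0 + ecost e + 4)) (I hi).
Proof.
move=> ic slo le_lh ehi Ilo body.
have fr0 s' : frame (Resume i e c) (set_reg s i lo) s' -> frame (For i e0 e c) s s'.
  case=> fr fa; split=> x; rewrite /= ?inE; last by move/fa.
  by rewrite negb_or => /andP[xi xc]; rewrite fr //= /upd (negPf xi).
have e1 : reg (set_reg s i lo) i = lo by rewrite /= /upd eqxx.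
have run := runs_resume ic e1 le_lh (fun s' fr => ehi s' (fr0 s' fr)) Ilo
  (fun k s' lt_k fr => body k s' lt_k (fr0 s' fr)).
apply: (@runs_weaken _ _ (ccost (Assign i e0) + ((hi - lo) * (b + ecost e + 6) + ecost e + 3))
  _ (I hi)) => //=; last by lia.
apply: runs_seq; apply: runs_loopfree; rewrite //= slo.
by apply: (runs_weaken run) => // s' _ [].
Qed.

Lemma sem_frame c s : loopfree c -> frame c s (sem c s).
Proof.
by move=> lf; have [n [s' [ex _ ->]]] := runs_loopfree lf (erefl (sem c s)); apply: exec_frame ex.
Qed.

(** * Breadth-first search *)

Definition visit (dd : nat) (st : (nat -> nat) * seq nat) (w : nat) :=
  if st.1 w is 0 then (upd st.1 w dd, rcons st.2 w) else st.

(** The list [q2] consists of the newly discovered vertices. As [dd] is nonzero, a vertex counts as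
    seen after its first occurrence in [l] and is queued only once. *)
Lemma foldl_visit dd d q l : 0 < dd -> exists q2,
  [/\ (foldl (visit dd) (d, q) l).2 = q ++ q2, uniq q2,
      (forall v, v \in q2 -> v \in l /\ d v = 0),
      (forall v, (foldl (visit dd) (d, q) l).1 v = if v \in q2 then dd else d v)
    & (forall v, v \in l -> (foldl (visit dd) (d, q) l).1 v != 0)].
Proof.
move=> dd_gt0; elim: l d q => [|w l IH] d q /=; first by exists [::]; rewrite cats0.
rewrite {2 4 6}/visit /=; case dw: (d w) => [|m].
  have [q2 [e2 uq2 q2P dP lP]] := IH (upd d w dd) (rcons q w).
  have wq2 : w \notin q2 by apply/negP => /q2P[_]; rewrite /upd eqxx; lia.
  exists (w :: q2); split=> [|||v|v].
  - by rewrite e2 cat_rcons.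
  - by rewrite /= wq2.
  - move=> v; rewrite !inE => /predU1P[->|]; first by rewrite eqxx.
    move=> vq; have [vl] := q2P v vq; rewrite /upd vl orbT.
    by have [vw|//] := eqVneq v w; rewrite -vw vq in wq2.
  - by rewrite dP inE /upd; case: eqP => [->|] //=; rewrite if_same.
  rewrite inE => /predU1P[->|/lP//]; rewrite dP (negPf wq2) /upd eqxx; lia.
have [q2 [e2 uq2 q2P dP lP]] := IH d q.
exists q2; split=> // v; first by move/q2P=> [vl ->]; rewrite inE vl orbT.
rewrite inE => /predU1P[->|/lP//]; rewrite dP; case: ifP => _; lia.
Qed.

(* [mem_nth] with the carrier in the form that [lia] recognizes. *)
Lemma mem_nth_nat (q : seq nat) i : i < size q -> nth 0 q i \in q.
Proof. exact: mem_nth. Qed.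

Section BFS.
Variables (N R : nat) (adj : nat -> seq nat) (src : seq nat).

Fixpoint reach (l v : nat) : Prop :=
  if l is l'.+1 then exists2 u, reach l' u & v \in adj u else v \in src.

Hypothesis adj_lt : forall u w, u < N -> w \in adj u -> w < N.
Hypothesis src_lt : forall v, v \in src -> v < N.

(* [d v] is [0] if [v] has not been seen and one plus its distance to [src]
   otherwise, [q] lists the vertices seen, and the first [h] of them have been
   expanded. *)
Record bfs_inv (d : nat -> nat) (q : seq nat) (h : nat) : Prop := BfsInv {
  bfs_uniq : uniq q;
  bfs_lt : forall v, v \in q -> v < N;
  bfs_seen : forall v, v < N -> (d v != 0) = (v \in q);
  bfs_mono : forall i j, i <= j -> j < size q -> d (nth 0 q i) <= d (nth 0 q j);
  bfs_near : forall v, v \in q -> h < size q -> d v <= (d (nth 0 q h)).+1;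
  bfs_bound : forall v, v \in q -> d v <= R.+1;
  bfs_sound : forall v, v \in q -> reach (d v).-1 v;
  bfs_complete : forall u w, u \in take h q -> d u <= R -> w \in adj u -> 0 < d w <= (d u).+1;
  bfs_src : forall v, v \in src -> d v = 1
}.

Lemma bfs_init d : (forall v, v < N -> d v = 0) ->
  let st := foldl (visit 1) (d, [::]) src in bfs_inv st.1 st.2 0.
Proof.
move=> d0 /=; have [q2 [-> uq2 q2P dP lP]] := @foldl_visit 1 d [::] src isT.
set d' := (foldl _ _ _).1 in dP lP *; rewrite cat0s.
have d1 v : v \in q2 -> d' v = 1 by rewrite dP => ->.
split=> //.
- by move=> v /q2P[/src_lt].
- by move=> v lt_v; rewrite dP; case: ifP => // _; rewrite d0.
- by move=> i j le_ij lt_j; rewrite !d1 ?mem_nth_nat //; lia.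
- by move=> v vq lt_q; rewrite !d1 // mem_nth.
- by move=> v vq; rewrite d1.
- by move=> v vq; rewrite d1 //; case: (q2P v vq).
- by move=> u w; rewrite take0.
move=> v vsrc; have := lP v vsrc; rewrite dP; case: ifP => // _.
by rewrite d0 // src_lt.
Qed.

Lemma take_nth_in h (q : seq nat) u : h < size q ->
  (u \in take h.+1 q) = (u \in take h q) || (u == nth 0 q h).
Proof. by move=> lt_h; rewrite (take_nth 0) // mem_rcons inE orbC. Qed.

(** A vertex at distance [R] has mark [R + 1] and is not expanded: [bfs_complete] concerns marks up
    to [R] only. *)
Lemma bfs_skip d q h : bfs_inv d q h -> h < size q -> R < d (nth 0 q h) -> bfs_inv d q h.+1.
Proof.
case=> uq lt seen mono near bound sound compl srcP lt_h far; split=> //.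
  move=> v vq lt_h1; apply: leq_trans (near v vq lt_h) _.
  by rewrite ltnS mono.
move=> u w; rewrite take_nth_in // => /orP[|/eqP->]; first exact: compl.
by move=> le_R; rewrite ltnNge le_R in far.
Qed.

Lemma bfs_expand d q h : bfs_inv d q h -> h < size q -> d (nth 0 q h) <= R ->
  let u := nth 0 q h in
  let st := foldl (visit (d u).+1) (d, q) (adj u) in bfs_inv st.1 st.2 h.+1.
Proof.
case=> uq lt seen mono near bound sound compl srcP lt_h close u /=.
have [q2 [-> uq2 q2P dP lP]] := @foldl_visit (d u).+1 d q (adj u) isT.
set d' := (foldl _ _ _).1 in dP lP *.
have uq_ : u \in q by apply: mem_nth.
have q2lt v : v \in q2 -> v < N by move/q2P=> [/(adj_lt (lt _ uq_))].
have old v : v \in q -> d' v = d v.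
  move=> vq; rewrite dP; case: ifP => // /q2P[_ dv0].
  by have := seen v (lt v vq); rewrite vq dv0.
have new v : v \in q2 -> d' v = (d u).+1 by move=> vq; rewrite dP vq.
have du : d' u = d u by apply: old.
have ge_u : 0 < d u by rewrite lt0n seen // lt.
(* By [bfs_near], no old mark exceeds [d u + 1], the mark of all new vertices, so appending these
   keeps the queue sorted by marks. *)
have mono' i j : i <= j -> j < size (q ++ q2) -> d' (nth 0 (q ++ q2) i) <= d' (nth 0 (q ++ q2) j).
  rewrite size_cat !nth_cat => le_ij lt_j.
  have [lt_jq|le_jq] := ltnP j (size q).
    have lt_iq : i < size q by lia.
    by rewrite lt_iq !old ?mem_nth_nat ?mono.
  have jq2 : nth 0 q2 (j - size q) \in q2 by apply: mem_nth_nat; lia.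
  rewrite (new _ jq2); have [lt_iq|le_iq] := ltnP i (size q).
    by rewrite old ?near ?mem_nth_nat.
  by rewrite new ?mem_nth_nat //; lia.
have hq : nth 0 (q ++ q2) h = u by rewrite nth_cat lt_h.
have near' v : v \in q ++ q2 -> d' v <= (d u).+1.
  by rewrite mem_cat => /orP[vq|/new->//]; rewrite old ?near.
split=> //.
- rewrite cat_uniq uq uq2 andbT; apply/hasPn => v vq2; apply/negP => /= vq.
  by have := seen v (lt v vq); rewrite vq; have [_ ->] := q2P v vq2.
- by move=> v; rewrite mem_cat => /orP[/lt|/q2lt].
- by move=> v lt_v; rewrite dP mem_cat; case: ifP => [_|]; rewrite ?orbT // orbF seen.
- move=> v vq lt_h1; apply: leq_trans (near' v vq) _.
  by rewrite ltnS -du -{1}hq mono'.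
- by move=> v /near' le_v; apply: leq_trans le_v _.
- move=> v; rewrite mem_cat => /orP[vq|vq]; first by rewrite old //; apply: sound.
  rewrite new // -pred_Sn -(prednK ge_u); exists u; last by case: (q2P v vq).
  exact: sound.
- move=> v w; rewrite takel_cat // take_nth_in // => /orP[vt|/eqP->].
    have vq := mem_take vt; rewrite old // => le_R wv.
    have /andP[w_gt0 w_le] := compl v w vt le_R wv.
    by rewrite old ?w_gt0 // -seen ?lt0n // -?lt0n // (adj_lt (lt v vq)).
  rewrite du => _ wu; rewrite lt0n lP //=.
  rewrite near' // mem_cat; move: (lP w wu); rewrite dP.
  by case: ifP; rewrite ?orbT // seen ?(adj_lt (lt u uq_)) // => _ ->.
by move=> v vsrc; rewrite old ?srcP // -seen ?srcP // src_lt.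
Qed.

Lemma reach_lt l v : reach l v -> v < N.
Proof. by elim: l v => [|l IH] v /=; [apply: src_lt | case=> u /IH; apply: adj_lt]. Qed.

Lemma bfs_final d q v : bfs_inv d q (size q) -> v < N ->
  d v != 0 <-> exists2 l, l <= R & reach l v.
Proof.
case=> uq lt seen mono near bound sound compl srcP lt_v; split=> [dv|[l le_R]].
  have vq : v \in q by rewrite -seen.
  by exists (d v).-1; [have := bound v vq; lia | apply: sound].
(* The upper bound is needed for the induction: it ensures that the predecessor on the walk has a
   mark of at most [R] and so was expanded. *)
suff H : reach l v -> 0 < d v <= l.+1 by move/H; lia.
elim: l v {lt_v} le_R => [|l IH] v le_R /=; first by move=> vs; rewrite srcP.
case=> u ur vu; have /andP[du_gt0 du_le] := IH u (ltnW le_R) ur.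
have uq' : u \in take (size q) q by rewrite take_size -seen -?lt0n ?(reach_lt ur).
have := compl u v uq' (leq_trans du_le le_R) vu; lia.
Qed.
End BFS.

(** * The program *)

(** Register [rNN] will hold twice the number of vertices, [rLo] and [rHi] delimit the old bag being
    read, and [rPos] is the next free cell of [aDat]. The arrays [aIn], [aD] and [aQ] are scratch
    space for bag membership, search marks and the queue. *)
Notation rN := 0 (only parsing).
Notation rR := 1 (only parsing).
Notation rM := 2 (only parsing).
Notation rNN := 3 (only parsing).
Notation rPos := 4 (only parsing).
Notation rT := 5 (only parsing).
Notation rLo := 6 (only parsing).
Notation rHi := 7 (only parsing).
Notation rI := 8 (only parsing).
Notation rHead := 9 (only parsing).
Notation rTail := 10 (only parsing).
Notation rU := 11 (only parsing).
Notation rO := 12 (only parsing).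
Notation rX := 13 (only parsing).
Notation rJ := 14 (only parsing).
Notation rW := 15 (only parsing).
Notation rD := 16 (only parsing).

Notation aOff := 0 (only parsing).
Notation aNbr := 1 (only parsing).
Notation aP := 2 (only parsing).
Notation aBag := 5 (only parsing).
Notation aDat := 6 (only parsing).
Notation aLay := 7 (only parsing).
Notation aIn := 8 (only parsing).
Notation aD := 9 (only parsing).
Notation aQ := 10 (only parsing).

(* The machine has no addition. *)
Definition Plus (e1 e2 : expr) : expr :=
  Defs.Sub (Reg rNN) (Defs.Sub (Defs.Sub (Reg rNN) e1) e2).

(** Two complements with respect to [rNN] give the sum, provided that no subtraction is
    truncated. *)
Lemma eval_Plus s e1 e2 : eval s e1 + eval s e2 <= reg s rNN ->
  eval s (Plus e1 e2) = eval s e1 + eval s e2.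
Proof. by rewrite /Plus /=; lia. Qed.

Definition visit_code : cmd :=
  If (Get aD (Reg rW)) Skip
    (Seq (Put aD (Reg rW) (Reg rD))
    (Seq (Put aQ (Reg rTail) (Reg rW))
         (Assign rTail (Succ (Reg rTail))))).

(* Leaves the vertex to expand in [rX] and the offset of its copy in [rO]. *)
Definition expand_prologue : cmd :=
  If (Defs.Sub (Reg rN) (Reg rU))
    (Seq (Assign rO (Const 0))
    (Seq (Assign rX (Reg rU))
         (If (Get aIn (Reg rU))
            (Seq (Assign rW (Plus (Reg rU) (Reg rN))) visit_code) Skip)))
    (Seq (Assign rO (Reg rN))
         (Assign rX (Defs.Sub (Reg rU) (Reg rN)))).

Definition visit_neighbour : cmd :=
  Seq (Assign rW (Plus (Get aNbr (Reg rJ)) (Reg rO))) visit_code.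

Definition expand_code : cmd :=
  Seq expand_prologue
      (For rJ (Get aOff (Reg rX)) (Get aOff (Succ (Reg rX))) visit_neighbour).

(** The data on which [visit] acts; cells of [aQ] from [rTail] on may be stale and are cut off. *)
Definition view (s : state) : (nat -> nat) * seq nat :=
  (arr s aD, mkseq (arr s aQ) (reg s rTail)).

Lemma mkseq_upd (f : nat -> nat) k v : mkseq (upd f k v) k.+1 = rcons (mkseq f k) v.
Proof.
rewrite mkseqS /upd eqxx; congr rcons; apply/eq_in_map => i; rewrite mem_iota => lt_i.
by rewrite (ltn_eqF (_ : i < k)).
Qed.

Lemma view_visit s :
  view (sem visit_code s) = visit (reg s rD) (view s) (reg s rW).
Proof. by rewrite /view /visit -mkseq_upd /=; case: (arr s 9 _). Qed.

Definition nbrs (off nbr : nat -> nat) (x : nat) : seq nat :=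
  [seq nbr j | j <- index_iota (off x) (off x.+1)].

Lemma map_index_iotaSr (A : Type) (f : nat -> A) a b : a <= b ->
  [seq f j | j <- index_iota a b.+1] = rcons [seq f j | j <- index_iota a b] (f b).
Proof.
by move=> le_ab; rewrite /index_iota subSn // -addn1 iotaD map_cat /= cats1 subnKC.
Qed.

#[local] Arguments upd A f i a j /.
#[local] Arguments visit_code : simpl never.

(** * The search in two copies of the graph *)

Section Search.
Variables (n r : nat) (off nbr : nat -> nat) (inb : pred nat).

(* The digraph has two copies [v] and [v + n] of each vertex, and the bag [inb]
   gives the only arcs from the first copy to the second: walks to [v + n] are
   walks to [v], plus one step, that pass through the bag. *)
Definition adj (c : nat) : seq nat :=
  if c < n then nseq (inb c) (c + n) ++ nbrs off nbr c
  else [seq w + n | w <- nbrs off nbr (c - n)].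

Definition deg (c : nat) : nat :=
  let x := if c < n then c else c - n in off x.+1 - off x.

Definition env (s : state) : Prop :=
  [/\ reg s rN = n, reg s rR = r & reg s rNN = n + n] /\
  [/\ arr s aOff = off, arr s aNbr = nbr & forall v, v < n -> (arr s aIn v != 0) = inb v].

Hypothesis off_le : forall x, x < n -> off x <= off x.+1.
Hypothesis nbr_lt : forall x j, x < n -> off x <= j < off x.+1 -> nbr j < n.

(** The prologue follows the arc to the second copy, if there is one, and the loop the remaining
    arcs, in the order of [adj]. A cost linear in the degree is what makes the whole search
    linear. *)
Lemma runs_expand s : env s -> reg s rU < n + n ->
  runs expand_code s (100 + 100 * deg (reg s rU))
    (fun s' => view s' = foldl (visit (reg s rD)) (view s) (adj (reg s rU))).
Proof.
case=> -[sN sR sNN] [sOff sNbr sIn] lt_u.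
set u := reg s rU in lt_u *; set x := if u < n then u else u - n.
pose o := if u < n then 0 else n.
have lt_x : x < n by rewrite /x; case: ifP; lia.
set s1 := sem expand_prologue s.
have fr1 : frame expand_prologue s s1 by apply: sem_frame.
have [s1x s1o s1v] : [/\ reg s1 rX = x, reg s1 rO = o &
    view s1 = foldl (visit (reg s rD)) (view s) (if u < n then nseq (inb u) (u + n) else [::])].
  rewrite /s1 /= sN -/u /o /x; case: ltnP => [lt_un|le_nu]; last first.
    by have -> : n - u = 0 by lia.
  have -> : n - u = (n - u).-1.+1 by lia.
  rewrite sNN -(sIn u lt_un).
  have -> : n + n - (n + n - u - n) = u + n by lia.
  case: (arr s 8 u) => [|m] //=.
  set s2 := set_reg _ 15 _.
  have [fr _] := @sem_frame visit_code s2 isT.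
  by rewrite view_visit !fr.
pose I k s' := view s' = foldl (visit (reg s rD)) (view s1) [seq nbr j + o | j <- index_iota (off x) k].
have run : runs (For rJ (Get aOff (Reg rX)) (Get aOff (Succ (Reg rX))) visit_neighbour) s1
  ((off x.+1 - off x) * (ccost visit_neighbour + 9) + 9) (I (off x.+1)).
  have [frr fra] := fr1.
  have s1Off : arr s1 aOff = off by rewrite fra.
  apply: runs_weaken;
    [apply: (@runs_for _ _ _ _ I (ccost visit_neighbour) _ (off x) (off x.+1)) | | by []] => //=.
  - by rewrite s1x s1Off.
  - exact: off_le.
  - by move=> s' [fr fa]; rewrite fr // fa // s1x s1Off.
  - by rewrite /I /index_iota subnn.
  - move=> k s' lt_k [fr fa] s'k Ik; apply: runs_loopfree => //.
    have -> : sem visit_neighbour s' = sem visit_code (set_reg s' rW (nbr k + o)).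
      have lt_nbr := nbr_lt lt_x lt_k.
      have le_o : o <= n by rewrite /o; case: ifP.
      have nE : arr s' aNbr (reg s' rJ) = nbr k by rewrite s'k fa // fra // sNbr.
      have oE : reg s' rO = o by rewrite fr.
      have nnE : reg s' rNN = n + n by rewrite fr // frr.
      rewrite -[LHS]/(sem visit_code (set_reg s' rW (eval s' (Plus (Get aNbr (Reg rJ)) (Reg rO))))).
      by rewrite eval_Plus [eval _ (Get _ _)]nE [eval _ (Reg _)]oE // nnE; lia.
    rewrite /I map_index_iotaSr; last by case/andP: lt_k.
    rewrite foldl_rcons -Ik -[LHS]/(view (sem visit_code _)) view_visit /=.
    by rewrite fr // frr.
apply: (@runs_weaken _ _ (ccost expand_prologue + ((off x.+1 - off x) * (ccost visit_neighbour + 9) + 9))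
  _ (I (off x.+1))).
- by apply: runs_seq; apply: runs_loopfree.
- have le1 : ccost expand_prologue <= 90 by [].
  have le2 : ccost visit_neighbour + 9 <= 100 by [].
  by have := leq_mul (leqnn (off x.+1 - off x)) le2; rewrite /deg -/x; lia.
move=> s' _ ->; rewrite s1v /adj /x /o -foldl_cat; case: ifP => // _.
by congr (foldl _ _ (_ ++ _)); apply: eq_map => j; rewrite addn0.
by rewrite /nbrs -map_comp.
Qed.

Definition bfs_prologue : cmd :=
  Seq (Assign rU (Get aQ (Reg rHead)))
  (Seq (Assign rHead (Succ (Reg rHead)))
       (Assign rD (Succ (Get aD (Reg rU))))).

(** The test holds iff the mark is at most [r + 1], that is, the distance is at most [r]. The search
    thus reaches distance [r + 1], the extra step being the change of copies. *)
Definition bfs_body : cmd :=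
  Seq bfs_prologue
    (If (Defs.Sub (Succ (Succ (Reg rR))) (Get aD (Reg rU))) expand_code Skip).

Definition bfs_code : cmd := While (Defs.Sub (Reg rTail) (Reg rHead)) bfs_body.

Definition bfs_cost : nat := \sum_(0 <= c < n + n) (200 + 100 * deg c).

Lemma sum_uniq_leq N (F : nat -> nat) (q : seq nat) : uniq q -> (forall v, v \in q -> v < N) ->
  \sum_(v <- q) F v <= \sum_(0 <= v < N) F v.
Proof.
move=> uq qN; rewrite [leqRHS](bigID (mem q)) /= -[leqLHS]addn0 leq_add //.
rewrite -[leqRHS]big_filter; apply: eq_leq; apply: perm_big; apply: uniq_perm => //.
  by rewrite filter_uniq // iota_uniq.
move=> v; rewrite mem_filter mem_index_iota /=; case vq: (v \in q) => //=.
by rewrite qN.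
Qed.

Lemma adj_lt u w : u < n + n -> w \in adj u -> w < n + n.
Proof.
rewrite /adj => lt_u; case: ltnP => [lt_un|le_nu]; last first.
  have lt_un : u - n < n by lia.
  case/mapP=> w' /mapP[j]; rewrite mem_index_iota => /(nbr_lt lt_un) lt_j -> ->; lia.
rewrite mem_cat mem_nseq => /orP[/andP[_ /eqP->]|]; first by lia.
by case/mapP=> j; rewrite mem_index_iota => /(nbr_lt lt_un) lt_j ->; lia.
Qed.

Lemma runs_bfs src s : env s -> (forall v, v \in src -> v < n + n) ->
  bfs_inv (n + n) r.+1 adj src (arr s aD) (mkseq (arr s aQ) (reg s rTail)) (reg s rHead) ->
  reg s rHead = 0 ->
  runs bfs_code s (bfs_cost + 10)
    (fun s' => bfs_inv (n + n) r.+1 adj src (arr s' aD) (mkseq (arr s' aQ) (reg s' rTail)) (reg s' rTail)).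
Proof.
move=> env_s src_lt inv0 head0.
pose queue s' := mkseq (arr s' aQ) (reg s' rTail).
pose c u := 200 + 100 * deg u.
pose I s' := [/\ frame bfs_code s s', reg s' rHead <= reg s' rTail &
  bfs_inv (n + n) r.+1 adj src (arr s' aD) (queue s') (reg s' rHead)].
(* The budget minus the cost of what has been dequeued; it suffices because the queue has no
   repetitions and lies below [n + n]. *)
pose phi s' := bfs_cost - \sum_(u <- take (reg s' rHead) (queue s')) c u.
pose hd s' := nth 0 (queue s') (reg s' rHead).
have step s' : I s' -> eval s' (Defs.Sub (Reg rTail) (Reg rHead)) != 0 ->
    runs bfs_body s' (190 + 100 * deg (hd s'))
      (fun s'' => I s'' /\ phi s'' + (190 + 100 * deg (hd s')) + 4 <= phi s').
  case=> fr le_ht inv /= ne.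
  have lt_ht : reg s' rHead < size (queue s') by rewrite size_mkseq; lia.
  have hdE : arr s' aQ (reg s' rHead) = hd s' by rewrite /hd nth_mkseq //; lia.
  have hd_lt : hd s' < n + n by apply: (bfs_lt inv); apply: mem_nth.
  have pay s'' q2 : reg s'' rHead = (reg s' rHead).+1 -> queue s'' = queue s' ++ q2 ->
      phi s'' + (190 + 100 * deg (hd s')) + 4 <= phi s'.
    move=> headE queueE; rewrite /phi headE queueE takel_cat //.
    have := @sum_uniq_leq _ c (take (reg s' rHead).+1 (queue s')) (take_uniq _ (bfs_uniq inv)) _.
    move/(_ _ (fun v vt => bfs_lt inv (mem_take vt))).
    rewrite -/bfs_cost (take_nth 0) // big_rcons /= -/(hd s') /c.
    by move: (bigop _ _ _) => S; lia.
  have [frr fra] := fr; have [[sN sR sNN] [sOff sNbr sIn]] := env_s.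
  have fr_body s'' : frame bfs_body s' s'' -> frame bfs_code s s'' by apply: frame_trans fr.
  apply: (@runs_weaken _ _ (ccost bfs_prologue +
    (ecost (Defs.Sub (Succ (Succ (Reg rR))) (Get aD (Reg rU))) + (100 + 100 * deg (hd s'))).+1)
    _ (fun s'' => exists q2, [/\ queue s'' = queue s' ++ q2, reg s'' rHead = (reg s' rHead).+1 &
       bfs_inv (n + n) r.+1 adj src (arr s'' aD) (queue s'') (reg s'' rHead)])); last first.
  - move=> s'' fr' [q2 [queueE headE inv']]; split; last exact: (pay s'' q2).
    split=> //; first exact: fr_body.
    move: lt_ht; rewrite headE -(size_mkseq (arr s'' aQ) (reg s'' rTail)) -/(queue s'') queueE size_cat.
    by lia.
  - by rewrite [ccost _]/= [ecost _]/=; lia.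
  apply: runs_seq; apply: runs_loopfree => //.
  set s1 := sem bfs_prologue s'.
  have s1U : reg s1 rU = hd s' by rewrite -hdE.
  have s1D : reg s1 rD = (arr s' aD (hd s')).+1 by rewrite -hdE.
  apply: runs_if => [|test]; last first.
    apply: (@runs_weaken _ _ (ccost Skip) _ (eq s1)); [exact: runs_loopfree | by [] | ].
    move=> _ _ <-; exists [::]; rewrite cats0; split=> //.
    apply: bfs_skip => //; rewrite -/(hd s') -hdE.
    by move: test; rewrite /= frr // sR; lia.
  move=> test.
  have env1 : env s1 by rewrite /env /= !frr // !fra.
  have lt1 : reg s1 rU < n + n by rewrite s1U.
  apply: (runs_weaken (runs_expand env1 lt1)); first by rewrite s1U.
  move=> s'' [frr' _]; rewrite s1U s1D => viewE.
  have le_R : arr s' aD (hd s') <= r.+1.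
    by move: test; rewrite -hdE /= frr // sR; lia.
  have := bfs_expand adj_lt src_lt inv lt_ht le_R.
  have [q2 [q2E _ _ _ _]] := @foldl_visit (arr s' aD (hd s')).+1 (arr s' aD) (queue s') (adj (hd s')) isT.
  cbv zeta; rewrite -/(hd s') -[(arr s' 9, queue s')]/(view s1) -viewE => inv'.
  exists q2; split; last by rewrite frr'.
    by rewrite -q2E -[(arr s' 9, queue s')]/(view s1) -viewE.
  by rewrite frr'.
have I0 : I s by split=> //; rewrite head0.
have := runs_while step I0; rewrite {1}/phi head0 take0 big_nil subn0.
move/runs_weaken; apply; first by rewrite [ecost _]/=; lia.
move=> s' _ [[_ le_ht inv] /= e0].
by have {2}-> : reg s' 10 = reg s' 9 by lia.
Qed.

Lemma bfs_cost_le :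
  bfs_cost <= 400 * n + 200 * \sum_(0 <= x < n) (off x.+1 - off x).
Proof.
rewrite /bfs_cost (@big_cat_nat _ _ _ n) //= ?leq_addr //.
rewrite -{2}[n]add0n big_addn addnK.
have -> : \sum_(0 <= c < n) (200 + 100 * deg c) = 200 * n + 100 * \sum_(0 <= x < n) (off x.+1 - off x).
  rewrite big_split /= sum_nat_const_nat subn0 mulnC -big_distrr /=; congr (_ + _ * _).
  by apply: eq_big_nat => x /andP[_ lt_x]; rewrite /deg lt_x.
have -> : \sum_(0 <= c < n) (200 + 100 * deg (c + n)) = 200 * n + 100 * \sum_(0 <= x < n) (off x.+1 - off x).
  rewrite big_split /= sum_nat_const_nat subn0 mulnC -big_distrr /=; congr (_ + _ * _).
  by apply: eq_big_nat => x _; rewrite /deg ltnNge leq_addl /= addnK.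
lia.
Qed.
End Search.

(** * The computation of one new bag *)

Lemma iotaSr k : iota 0 k.+1 = rcons (iota 0 k) k.
Proof. by rewrite -addn1 iotaD cats1. Qed.

(** The scratch arrays are arbitrary at the start and hold the marks of the previous bag later
    on. *)
Definition clear_code : cmd :=
  For rI (Const 0) (Reg rNN) (Seq (Put aIn (Reg rI) (Const 0)) (Put aD (Reg rI) (Const 0))).

Definition mark_code : cmd :=
  For rJ (Reg rLo) (Reg rHi) (Put aIn (Get aDat (Reg rJ)) (Const 1)).

Definition source_code : cmd :=
  Seq (Seq (Assign rTail (Const 0)) (Seq (Assign rHead (Const 0)) (Assign rD (Const 1))))
  (For rI (Const 0) (Reg rN)
     (If (Get aP (Reg rI)) (Seq (Assign rW (Reg rI)) visit_code) Skip)).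

(* For [a <= 1], the number [1 - (1 - a - b)] is nonzero iff [a] or [b] is. *)
Definition output_code : cmd :=
  For rI (Const 0) (Reg rN)
    (If (Defs.Sub (Const 1)
           (Defs.Sub (Defs.Sub (Const 1) (Get aIn (Reg rI))) (Get aD (Plus (Reg rI) (Reg rN)))))
       (Seq (Put aDat (Reg rPos) (Reg rI)) (Assign rPos (Succ (Reg rPos)))) Skip).

Definition bag_code : cmd :=
  Seq clear_code (Seq mark_code (Seq source_code (Seq bfs_code output_code))).

Lemma runs_clear s N : reg s rNN = N ->
  runs clear_code s (20 * N + 10) (fun s' => forall v, v < N -> arr s' aIn v = 0 /\ arr s' aD v = 0).
Proof.
move=> sN; pose I k s' := forall v, v < k -> arr s' aIn v = 0 /\ arr s' aD v = 0.
apply: runs_weaken; [apply: (@runs_for _ _ _ _ I 6 _ 0 N) | | by []] => //=; last by lia.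
  by move=> s' [fr _]; rewrite fr.
move=> k s' _ _ s'k Ik; apply: runs_loopfree => // v; rewrite ltnS leq_eqVlt /= s'k.
by case: eqP => //= _ /Ik.
Qed.

Lemma runs_mark s n L : (forall v, v < n -> arr s aIn v = 0) -> reg s rLo <= reg s rHi ->
  L = [seq arr s aDat j | j <- index_iota (reg s rLo) (reg s rHi)] ->
  runs mark_code s (20 * size L + 10)
    (fun s' => forall v, v < n -> (arr s' aIn v != 0) = (v \in L)).
Proof.
move=> in0 le_lh ->; set lo := reg s rLo in le_lh *; set hi := reg s rHi in le_lh *.
pose I k s' := forall v, v < n ->
  (arr s' aIn v != 0) = (v \in [seq arr s aDat j | j <- index_iota lo k]).
apply: runs_weaken; [apply: (@runs_for _ _ _ _ I 4 _ lo hi) | | by []] => //=.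
- by move=> s' [fr _]; rewrite fr.
- by move=> v lt_v; rewrite /= in0 // /index_iota subnn.
- move=> k s' /andP[le_k _] [_ fa] s'k Ik; apply: runs_loopfree => // v lt_v.
  rewrite map_index_iotaSr // mem_rcons inE -Ik //= s'k fa //.
  by case: (v == _).
by rewrite size_map size_iota; lia.
Qed.

Lemma runs_source s n src :
  reg s rN = n -> src = [seq i <- iota 0 n | arr s aP i != 0] ->
  runs source_code s (50 * n + 50)
    (fun s' => view s' = foldl (visit 1) (arr s aD, [::]) src /\ reg s' rHead = 0).
Proof.
move=> sN ->.
pose I k s' := view s' = foldl (visit 1) (arr s aD, [::]) [seq i <- iota 0 k | arr s aP i != 0].
set body := If (Get aP (Reg rI)) (Seq (Assign rW (Reg rI)) visit_code) Skip.
apply: (@runs_weaken _ _ (10 + ((n - 0) * (ccost body + 1 + 6) + (1 + 1 + 4))) _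
  (fun s' => I n s' /\ reg s' rHead = 0)) => //; last first.
  have le_body : ccost body + 1 + 6 <= 50 by [].
  by have := leq_mul (leqnn n) le_body; rewrite subn0; lia.
apply: (@runs_seq _ _ _ 10).
apply: runs_loopfree_le => //; set s1 := sem _ s.
have [frr fra] := @sem_frame
  (Seq (Assign rTail (Const 0)) (Seq (Assign rHead (Const 0)) (Assign rD (Const 1)))) s isT.
rewrite -/s1 in frr fra.
have run : runs (For rI (Const 0) (Reg rN) body) s1 ((n - 0) * (ccost body + 1 + 6) + (1 + 1 + 4)) (I n).
  apply: (@runs_for _ _ _ _ I) => //.
  - by move=> s' [fr _]; rewrite /= fr // frr.
  - move=> k s' lt_k [fr fa] s'k Ik; apply: runs_loopfree => //.
    rewrite /I iotaSr filter_rcons [sem _ _]/= s'k.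
    have -> : arr s' 2 = arr s 2 by rewrite fa // fra.
    case: (arr s 2 k) => [|m] //; rewrite foldl_rcons -Ik.
    by rewrite -[LHS]/(view (sem visit_code (set_reg s' rW k))) view_visit /= fr // frr.
apply: (runs_weaken run) => // s' [fr _] Is'; split=> //.
by rewrite fr // frr.
Qed.

Lemma runs_output s n (f : pred nat) :
  reg s rN = n -> reg s rNN = n + n ->
  (forall v, v < n -> f v = (arr s aIn v != 0) || (arr s aD (v + n) != 0)) ->
  runs output_code s (50 * n + 10) (fun s' =>
    [/\ reg s rPos <= reg s' rPos,
        [seq arr s' aDat j | j <- index_iota (reg s rPos) (reg s' rPos)] = filter f (iota 0 n)
      & forall j, j < reg s rPos -> arr s' aDat j = arr s aDat j]).
Proof.
move=> sN sNN fP; set pos := reg s rPos.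
pose I k s' := [/\ pos <= reg s' rPos,
        [seq arr s' aDat j | j <- index_iota pos (reg s' rPos)] = filter f (iota 0 k)
      & forall j, j < pos -> arr s' aDat j = arr s aDat j].
apply: runs_weaken; [apply: (@runs_for _ _ _ _ I 40 _ 0 n) | | by []] => //.
- by move=> s' [fr _]; rewrite /= fr.
- by rewrite /I /= /index_iota subnn.
- move=> k s' /andP[_ lt_k] [fr fa] s'k [le_pos datE keep].
  apply: runs_loopfree_le => //.
  rewrite /I iotaSr filter_rcons -datE.
  have test : eval s' (Defs.Sub (Const 1)
           (Defs.Sub (Defs.Sub (Const 1) (Get aIn (Reg rI))) (Get aD (Plus (Reg rI) (Reg rN))))) = f k.
    have plusE : eval s' (Plus (Reg rI) (Reg rN)) = k + n.
      by rewrite eval_Plus /= ?s'k ?fr // sN ?sNN //; lia.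
    rewrite -[LHS]/(1 - (1 - arr s' aIn (reg s' rI) - arr s' aD (eval s' (Plus (Reg rI) (Reg rN))))).
    rewrite plusE s'k !fa // fP //.
    by case: (arr s 8 k) => [|m1]; case: (arr s 9 _) => [|m2] /=; lia.
  rewrite [sem _ _]/sem test -/sem /= -/sem.
  case: (f k) => //; rewrite map_index_iotaSr // s'k; split=> [|| j lt_j].
  - exact: leqW.
  - rewrite /= eqxx; congr rcons; apply/eq_in_map => j; rewrite mem_index_iota => /andP[_ lt_j].
    by rewrite (ltn_eqF lt_j).
  by rewrite /= (ltn_eqF (leq_trans lt_j le_pos)) keep.
by rewrite /=; lia.
Qed.

Lemma runs_bag n r off nbr s L src (f : pred nat) :
  [/\ reg s rN = n, reg s rR = r & reg s rNN = n + n] ->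
  [/\ arr s aOff = off, arr s aNbr = nbr & src = [seq i <- iota 0 n | arr s aP i != 0]] ->
  (forall x, x < n -> off x <= off x.+1) ->
  (forall x j, x < n -> off x <= j < off x.+1 -> nbr j < n) ->
  reg s rLo <= reg s rHi -> L = [seq arr s aDat j | j <- index_iota (reg s rLo) (reg s rHi)] ->
  (forall v, v < n -> f v <->
     v \in L \/ exists2 l, l <= r.+1 & reach (adj n off nbr (mem L)) src l (v + n)) ->
  runs bag_code s
    (1000 * n + 200 * \sum_(0 <= x < n) (off x.+1 - off x) + 20 * size L + 200)
    (fun s' =>
    [/\ reg s rPos <= reg s' rPos,
        [seq arr s' aDat j | j <- index_iota (reg s rPos) (reg s' rPos)] = filter f (iota 0 n)
      & forall j, j < reg s rPos -> arr s' aDat j = arr s aDat j]).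
Proof.
move=> [sN sR sNN] [sOff sNbr srcE] off_le nbr_lt le_lh LE fP.
have src_lt v : v \in src -> v < n + n.
  by rewrite srcE mem_filter mem_iota => /andP[_]; lia.
pose cost := 20 * (n + n) + 10 + (20 * size L + 10 + (50 * n + 50 +
  (bfs_cost n off + 10 + (50 * n + 10)))).
have costE : cost <= 1000 * n + 200 * \sum_(0 <= x < n) (off x.+1 - off x) + 20 * size L + 200.
  by have := bfs_cost_le n off; rewrite /cost; lia.
apply: (@runs_weaken _ _ cost _ _ _ _ costE (fun _ _ h => h)).
apply: runs_seq; apply: (runs_weaken (runs_clear sNN)) => // s1 [fr1 fa1] zero1.
apply: runs_seq.
have LE1 : L = [seq arr s1 aDat j | j <- index_iota (reg s1 rLo) (reg s1 rHi)].
  by rewrite !fr1 // fa1.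
apply: (runs_weaken (@runs_mark s1 n L _ _ LE1)) => // [v lt_v||s2 [fr2 fa2] in2].
- by case: (zero1 v) => //; lia.
- by rewrite !fr1.
apply: runs_seq.
have srcE2 : src = [seq i <- iota 0 n | arr s2 aP i != 0] by rewrite fa2 // fa1.
apply: (runs_weaken (@runs_source s2 n src _ srcE2)) => // [|s3 [fr3 fa3] [view3 head3]].
  by rewrite fr2 // fr1.
apply: runs_seq.
have env3 : env n r off nbr (mem L) s3.
  split; first by rewrite !fr3 ?fr2 ?fr1.
  split=> [|| v lt_v]; first by rewrite fa3 ?fa2 ?fa1.
    by rewrite fa3 ?fa2 ?fa1.
  by rewrite fa3 // in2.
have adj_lt' := @adj_lt n off nbr (mem L) nbr_lt.
have inv3 : bfs_inv (n + n) r.+1 (adj n off nbr (mem L)) src (arr s3 aD)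
    (mkseq (arr s3 aQ) (reg s3 rTail)) (reg s3 rHead).
  rewrite head3 -[arr s3 _]/(view s3).1 -[mkseq _ _]/(view s3).2 view3.
  apply: bfs_init => // v lt_v; rewrite fa2 //; by case: (zero1 v lt_v).
apply: (runs_weaken (runs_bfs off_le nbr_lt env3 src_lt inv3 head3)) => // s4 [fr4 fa4] inv4.
have frame4 : [/\ reg s4 rN = n, reg s4 rNN = n + n, reg s4 rPos = reg s rPos & arr s4 aDat = arr s aDat].
  by split; rewrite ?fr4 ?fr3 ?fr2 ?fr1 ?fa4 ?fa3 ?fa2 ?fa1.
have [s4N s4NN <- <-] := frame4.
apply: runs_output => // v lt_v.
have inE : (arr s4 aIn v != 0) = (v \in L) by rewrite fa4 // fa3 // in2.
have lt_vn : v + n < n + n by lia.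
(* The search stops with its head at the end of the queue, so every entry has been processed, as
   [bfs_final] requires. *)
rewrite -{2}(size_mkseq (arr s4 aQ) (reg s4 rTail)) in inv4.
have reachE := bfs_final adj_lt' src_lt inv4 lt_vn.
rewrite inE; have [f_to f_of] := fP v lt_v.
apply/idP/orP => [/f_to[]|[vL|/reachE vr]]; [by left | | apply: f_of; by left | apply: f_of; by right].
by move/reachE; right.
Qed.

(** Double counting of incidences: the edges at [x] are as many as its neighbours, and an edge has
    at most two elements. *)
Lemma sum_degree_le (V : finType) (G : sgraph V) :
  \sum_x #|neighbours G x| <= 2 * #|edge_set G|.
Proof.
apply: (@leq_trans (\sum_x \sum_(e in edge_set G) (x \in e))).
  apply: leq_sum => x _; rewrite -big_mkcondr /= sum1_card.
  rewrite -(@card_in_imset _ _ (fun y => [set x; y])) => [|y z]; last first.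
    rewrite !inE => xy xz /setP/(_ y); rewrite !inE eqxx orbT => /esym/orP[/eqP yx|/eqP //].
    by rewrite yx edge_irr in xy.
  apply/subset_leq_card/subsetP => _ /imsetP[y xy ->]; rewrite inE in xy.
  by apply/andP; split; [apply/imsetP; exists (x, y); rewrite ?inE | apply: set21].
rewrite exchange_big /= mulnC -sum_nat_const; apply: leq_sum => _ /imsetP[p _ ->].
by rewrite -big_mkcond /= sum1_card cards2; case: eqP.
Qed.

Definition ords (n : nat) (A : {set 'I_n}) : seq nat := map (@nat_of_ord n) (enum A).

Lemma mem_ords n (A : {set 'I_n}) (v : 'I_n) : (nat_of_ord v \in ords A) = (v \in A).
Proof. by rewrite /ords (mem_map (@ord_inj n)) mem_enum. Qed.

Lemma ords_lt n (A : {set 'I_n}) v : v \in ords A -> v < n.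
Proof. by case/mapP=> w _ ->. Qed.

(** * Reachability in the two copies and walks through the bag *)

Section Reachability.
Variables (n : nat) (G : sgraph 'I_n) (P X : {set 'I_n}) (off nbr : nat -> nat).
Variables (L src : seq nat).
Hypothesis nbrsP : forall v : 'I_n, perm_eq (nbrs off nbr v) (ords (neighbours G v)).
Hypothesis LP : perm_eq L (ords X).
Hypothesis srcP : src =i (ords P).

Lemma mem_nbrs (u v : 'I_n) : (nat_of_ord v \in nbrs off nbr u) = edge G u v.
Proof. by rewrite (perm_mem (nbrsP u)) mem_ords inE. Qed.

Lemma nbrs_lt (u : 'I_n) v : v \in nbrs off nbr u -> v < n.
Proof. by rewrite (perm_mem (nbrsP u)) => /ords_lt. Qed.

Notation D := (adj n off nbr (mem L)).

Lemma mem_adj_low (u v : 'I_n) : (nat_of_ord v \in D u) = edge G u v.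
Proof.
rewrite /adj ltn_ord mem_cat mem_nbrs mem_nseq.
have /negPf-> : nat_of_ord v != u + n by have := ltn_ord v; lia.
by rewrite andbF.
Qed.

Lemma mem_adj_cross (u v : 'I_n) : (v + n \in D u) = (v \in X) && (u == v).
Proof.
rewrite /adj ltn_ord mem_cat mem_nseq eqn_add2r.
have /negPf-> : v + n \notin nbrs off nbr u by apply/negP => /nbrs_lt; lia.
rewrite orbF -[u == v]/(nat_of_ord u == nat_of_ord v) [_ == nat_of_ord u]eq_sym /=.
have -> : (nat_of_ord u \in L) = (u \in X) by rewrite (perm_mem LP) mem_ords.
rewrite lt0b; case: eqP => [/ord_inj->|]; by rewrite ?andbF.
Qed.

Lemma mem_adj_high (u v : 'I_n) : (v + n \in D (u + n)) = edge G u v.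
Proof.
by rewrite /adj ltnNge leq_addl /= addnK (mem_map (@addIn n)) mem_nbrs.
Qed.

Lemma mem_adj_back (u v : 'I_n) : (nat_of_ord v \in D (u + n)) = false.
Proof.
rewrite /adj ltnNge leq_addl /=; apply/negP => /mapP[w _ e].
by have := ltn_ord v; rewrite [nat_of_ord v]e; lia.
Qed.

Lemma code_split c : c < n + n -> exists u : 'I_n, c = u \/ c = u + n.
Proof.
move=> lt_c; have [lt_cn|le_nc] := ltnP c n; first by exists (Ordinal lt_cn); left.
have lt_cn : c - n < n by lia.
by exists (Ordinal lt_cn); right; rewrite /= subnK.
Qed.

Lemma nbr_lt x j : x < n -> off x <= j < off x.+1 -> nbr j < n.
Proof.
move=> lt_x lt_j; apply: (@nbrs_lt (Ordinal lt_x)).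
by apply/mapP; exists j; rewrite ?mem_index_iota.
Qed.

Lemma src_lt_code v : v \in src -> v < n + n.
Proof. by rewrite srcP => /ords_lt; lia. Qed.

(** No arc returns from the second copy, so the search stays in [G] until it reaches [v]; the walk
    is read backwards. *)
Lemma reach_low l (v : 'I_n) :
  reach D src l v <-> exists2 p, p \in P & walk G l v p.
Proof.
elim: l v => [|l IH] v /=.
  by rewrite srcP mem_ords; split=> [vP|[p pP /eqP->]//]; exists v.
split=> [[u ur vu]|[p pP /existsP[w /andP[vw wp]]]].
  have [w [e|e]] := code_split (reach_lt (adj_lt nbr_lt) src_lt_code ur); subst u.
    have [p pP wp] := (IH w).1 ur; exists p => //.
    by apply/existsP; exists w; rewrite wp andbT edge_sym -mem_adj_low.
  by rewrite mem_adj_back in vu.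
exists w; last by rewrite mem_adj_low edge_sym.
by apply/IH; exists p.
Qed.

(** The sources are in the first copy, and the copies are changed exactly once, at some [x] in [X]:
    [a] steps come before the change and [b] after it, whence [(a + b).+1]. *)
Lemma reach_high l (v : 'I_n) :
  reach D src l (v + n) <->
  exists a b x p, [/\ l = (a + b).+1, x \in X, p \in P, walk G a x p & walk G b v x].
Proof.
split=> [|[a [b [x [p [-> xX pP xp]]]]]].
  elim: l v => [|l IH] v /=; first by rewrite srcP => /ords_lt; lia.
  case=> u ur vu.
  have [w [e|e]] := code_split (reach_lt (adj_lt nbr_lt) src_lt_code ur); subst u.
    move: vu; rewrite mem_adj_cross => /andP[vX /eqP e]; subst w.
    have [p pP vp] := (reach_low l v).1 ur.
    by exists l, 0, v, p; rewrite addn0 /= eqxx.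
  have [a [b [x [p [-> xX pP xp wx]]]]] := IH _ ur.
  exists a, b.+1, x, p; rewrite addnS; split=> //.
  by apply/existsP; exists w; apply/andP; split; rewrite // edge_sym -mem_adj_high.
elim: b v => [|b IH] v.
  move/eqP->; rewrite addn0; exists x; last by rewrite mem_adj_cross xX eqxx.
  by apply/reach_low; exists p.
case/existsP=> w /andP[vw /IH wr]; rewrite addnS; exists (w + n) => //.
by rewrite mem_adj_high edge_sym.
Qed.

Lemma reach_passes r (v : 'I_n) :
  (exists2 l, l <= r.+1 & reach D src l (v + n)) <->
  exists2 x, x \in X & passes G P r x v.
Proof.
split=> [[l le_l /reach_high[a [b [x [p [le xX pP xp vx]]]]]]|[x xX /passesP[a [b [p [le_r vx pP px]]]]]].
  exists x => //; apply/passesP; exists a, b, p; split=> //; first by lia.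
  exact: walk_sym.
exists (a + b).+1 => //; apply/reach_high; exists a, b, x, p; split=> //.
exact: walk_sym.
Qed.
End Reachability.

(** * The loop over all bags and its running time *)

Definition coarsen_code : cmd :=
  Seq (Assign rNN (Succ (Reg rNN)))
      (Put aLay (Reg rI) (Div (Div (Get aLay (Reg rI)) (Reg rR)) (Const 2))).

(** Output starts at the end of the last old bag. The old start of bag 0 is saved in [rLo] before
    its cell receives the new start. *)
Definition setup_code : cmd :=
  Seq (Assign rNN (Reg rN))
  (Seq (For rI (Const 0) (Reg rN) coarsen_code)
  (Seq (Assign rPos (Get aBag (Reg rM)))
  (Seq (Assign rLo (Get aBag (Const 0)))
       (Put aBag (Const 0) (Reg rPos))))).

(** The old end of bag [t] is also the old start of bag [t + 1]; it is kept in [rHi] because its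
    cell is overwritten. *)
Definition step_code : cmd :=
  Seq (Assign rHi (Get aBag (Succ (Reg rT))))
  (Seq bag_code
  (Seq (Assign rLo (Reg rHi)) (Put aBag (Succ (Reg rT)) (Reg rPos)))).

Definition main_code : cmd := Seq setup_code (For rT (Const 0) (Reg rM) step_code).

Lemma runs_setup s n r m : reg s rN = n -> reg s rR = r -> reg s rM = m ->
  runs setup_code s (30 * n + 30) (fun s' =>
    [/\ reg s' rNN = n + n, forall v, v < n -> arr s' aLay v = arr s aLay v %/ r %/ 2 ,
        reg s' rPos = arr s aBag m, reg s' rLo = arr s aBag 0
      & arr s' aBag = upd (arr s aBag) 0 (arr s aBag m)]).
Proof.
move=> sN sR sM.
(* The loop over the vertices also raises [rNN] from [n] to [2n], which makes [Plus] available
   afterwards. *)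
pose I k s' := reg s' rNN = n + k /\
  forall v, arr s' aLay v = if v < k then arr s aLay v %/ r %/ 2 else arr s aLay v.
pose s1 := sem (Assign rNN (Reg rN)) s.
have run : runs (For rI (Const 0) (Reg rN) coarsen_code) s1
  ((n - 0) * (ccost coarsen_code + 1 + 6) + (1 + 1 + 4)) (I n).
  apply: (@runs_for _ _ _ _ I) => //.
  - by move=> s' [fr _]; rewrite /= fr.
  - by split; rewrite ?addn0 //= sN.
  - move=> k s' lt_k [fr fa] s'k [nnE layE]; apply: runs_loopfree => //; split.
      by rewrite /= nnE addnS.
    move=> v; rewrite [LHS]/= s'k fr // [reg s1 _]sR ltnS leq_eqVlt.
    by case: eqP => [->|_] /=; rewrite layE ?ltnn.
apply: (@runs_weaken _ _ (2 + ((n - 0) * (ccost coarsen_code + 1 + 6) + (1 + 1 + 4) + 15))); last 1 first.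
- by move=> s' _ H; exact: H.
- apply: runs_seq; apply: runs_loopfree => //; apply: runs_seq.
  apply: (runs_weaken run) => // s2 [fr fa] [nnE layE]; apply: runs_loopfree_le => //.
  have s2M : reg s2 rM = m by rewrite fr.
  have s2Bag : arr s2 aBag = arr s aBag by rewrite fa.
  split=> // [v lt_v|||]; rewrite /= ?s2M ?s2Bag //.
  by rewrite layE lt_v.
have le_body : ccost coarsen_code + 1 + 6 <= 30 by [].
by have := leq_mul (leqnn n) le_body; rewrite subn0; lia.
Qed.

(* The new bags are written behind the old ones, so that the bags that remain to
   be read are not overwritten. *)
Lemma runs_main n (G : sgraph 'I_n) (P : {set 'I_n}) r m (T : sgraph 'I_m)
    (X : 'I_m -> {set 'I_n}) lay s :
  0 < m -> stores_instance s G P r -> stores_decomposition s T X lay ->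
  runs main_code s (3000 * (m * maxn 1 (n + #|edge_set G|)))
    (fun s' => stores_decomposition s' T (enlarge G P r X) (coarsen r lay)).
Proof.
move=> m_gt0 [[sN nbrsP] sP sR] [[sM treeP] bagsP layP].
set boff := arr s aBag; set bdat := arr s aDat.
pose W := maxn 1 (n + #|edge_set G|).
pose off := arr s aOff; pose nbr := arr s aNbr.
pose src := [seq i <- iota 0 n | arr s aP i != 0].
have src_eq : src =i ords P.
  move=> v; rewrite mem_filter mem_iota add0n leq0n /=; apply/andP/idP => [[Pv lt_v]|vP].
    by move: Pv; rewrite (sP (Ordinal lt_v)) eqb0 negbK -(mem_ords P (Ordinal lt_v)).
  have lt_v := ords_lt vP; split=> //.
  by rewrite (sP (Ordinal lt_v)) eqb0 negbK -(mem_ords P (Ordinal lt_v)).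
have nbrs_perm (v : 'I_n) : perm_eq (nbrs off nbr v) (ords (neighbours G v)).
  by have [_] := nbrsP v.
have off_le x : x < n -> off x <= off x.+1.
  by move=> lt_x; have [] := nbrsP (Ordinal lt_x).
have nbr_lt' := nbr_lt nbrs_perm.
have deg_le : \sum_(0 <= x < n) (off x.+1 - off x) <= 2 * #|edge_set G|.
  apply: leq_trans (sum_degree_le G); rewrite big_mkord; apply: leq_sum => v _.
  by have := perm_size (nbrs_perm v); rewrite /nbrs /ords !size_map size_iota -cardE => ->.
have boff_le t : t < m -> boff t <= boff t.+1.
  by move=> lt_t; have [] := bagsP (Ordinal lt_t).
have boff_max t : t <= m -> boff t <= boff m.
  move=> le_t; rewrite -(subKn le_t); elim: (m - t) (leq_subr t m) => [|k IH] lt_k.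
    by rewrite subn0.
  have e : m - k = (m - k.+1).+1 by lia.
  apply: leq_trans (IH (ltnW lt_k)); rewrite e; apply: boff_le; lia.
pose block s' (i : nat) := [seq arr s' aDat j | j <- index_iota (arr s' aBag i) (arr s' aBag i.+1)].
(* Offsets up to [t] are new and those above [t] still old; the old offset of [t] survives in [rLo]
   only. *)
pose I t s' := [/\ [/\ reg s' rNN = n + n, reg s' rLo = boff t & arr s' aBag t = reg s' rPos],
  forall i, t < i -> arr s' aBag i = boff i,
  boff m <= reg s' rPos /\ (forall j, j < boff m -> arr s' aDat j = bdat j)
  & forall i : 'I_m, i < t -> [/\ arr s' aBag i <= arr s' aBag i.+1, arr s' aBag i.+1 <= reg s' rPos
      & perm_eq (block s' i) (ords (enlarge G P r X i))]].
have nW : n + #|edge_set G| <= W by apply: leq_maxr.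
have W_gt0 : 0 < W by apply: leq_maxl.
have step s0 t s1 : frame setup_code s s0 -> t < m ->
    frame (For rT (Const 0) (Reg rM) step_code) s0 s1 -> reg s1 rT = t -> I t s1 ->
    runs step_code s1 (2000 * W) (fun s2 => I t.+1 (set_reg s2 rT t.+1)).
  move=> [fr0 fa0] lt_t [fr1 fa1] s1T [[s1NN s1Lo s1Bag] s1Old [s1Pos s1Dat] s1New].
  pose t' := Ordinal lt_t.
  pose L := [seq bdat j | j <- index_iota (boff t) (boff t.+1)].
  have Lperm : perm_eq L (ords (X t')) by have [_] := bagsP t'.
  have L_le : size L <= n.
    by rewrite (perm_size Lperm) size_map -cardE -[leqRHS]card_ord max_card.
  pose f := mem (ords (enlarge G P r X t')).
  have fP v : v < n -> f v <->
      v \in L \/ exists2 l, l <= r.+1 & reach (adj n off nbr (mem L)) src l (v + n).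
    move=> lt_v; pose v' := Ordinal lt_v.
    have := reach_passes nbrs_perm Lperm src_eq r v'.
    rewrite -[f v]/(nat_of_ord v' \in ords _) mem_ords (perm_mem Lperm).
    rewrite -[v \in ords _]/(nat_of_ord v' \in ords _) mem_ords => [[to of_]].
    by split=> [/enlargeP[|/of_]|[vX|/to vX]]; [left | right | apply/enlargeP; left | apply/enlargeP; right].
  pose bagC := 1000 * n + 200 * \sum_(0 <= x < n) (off x.+1 - off x) + 20 * size L + 200.
  (* The degrees sum to at most twice the number of edges and [L] has at most [n] entries; [W >= 1]
     absorbs the constants. *)
  apply: (@runs_weaken _ _ (4 + (bagC + 6)) _ _ _ _ _ (fun _ _ h => h)); last by rewrite /bagC; lia.
  apply: runs_seq; apply: runs_loopfree_le => //; set s2 := sem _ s1.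
  have s2Hi : reg s2 rHi = boff t.+1 by rewrite /s2 /= s1T s1Old.
  have s2Lo : reg s2 rLo = boff t by [].
  have LE : L = [seq arr s2 aDat j | j <- index_iota (reg s2 rLo) (reg s2 rHi)].
    rewrite s2Lo s2Hi; apply/eq_in_map => j; rewrite mem_index_iota => /andP[_ lt_j].
    by rewrite -[arr s2 _]/(arr s1 aDat) s1Dat // (leq_trans lt_j) // boff_max.
  have regs2 : [/\ reg s2 rN = n, reg s2 rR = r & reg s2 rNN = n + n].
    by rewrite -[reg s2 _]/(reg s1 0) -[reg s2 rR]/(reg s1 rR) !fr1 // !fr0.
  have arrs2 : [/\ arr s2 aOff = off, arr s2 aNbr = nbr & src = [seq i <- iota 0 n | arr s2 aP i != 0]].
    rewrite -[arr s2 aOff]/(arr s1 aOff) -[arr s2 aNbr]/(arr s1 aNbr) -[arr s2 aP]/(arr s1 aP).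
    by rewrite !fa1 // !fa0.
  have le_lh : reg s2 rLo <= reg s2 rHi by rewrite s2Lo s2Hi boff_le.
  apply: runs_seq; apply: (runs_weaken (runs_bag regs2 arrs2 off_le nbr_lt' le_lh LE fP)) => //.
  move=> s3 [fr3 fa3] [le_pos s3Blk s3Keep]; apply: runs_loopfree_le => //.
  set s4 := set_reg _ _ _.
  have s4Bag : arr s4 aBag = upd (arr s1 aBag) t.+1 (reg s3 rPos).
    by rewrite /s4 [LHS]/= fa3 // fr3 // -[reg s2 5]/(reg s1 rT) s1T.
  have s4Dat : arr s4 aDat = arr s3 aDat by [].
  have s4Pos : reg s4 rPos = reg s3 rPos by [].
  rewrite -[reg s2 _]/(reg s1 rPos) in le_pos s3Blk s3Keep.
  rewrite -[arr s2 _]/(arr s1 aDat) in s3Keep.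
  split.
  - rewrite s4Bag s4Pos /upd eqxx; split=> //.
      by rewrite -[LHS]/(reg s3 rNN) fr3.
    by rewrite -[LHS]/(reg s3 rHi) fr3.
  - move=> i lt_i; rewrite s4Bag /upd gtn_eqF // s1Old //; lia.
  - rewrite s4Pos s4Dat; split=> [|j lt_j]; first exact: leq_trans le_pos.
    by rewrite s3Keep ?s1Dat // (leq_trans lt_j).
  move=> i; rewrite ltnS leq_eqVlt => /predU1P[it|lt_i]; last first.
    have [le_i le_iPos Hperm] := s1New i lt_i.
    have [ne1 ne2] : (i == t.+1 :> nat) = false /\ (i.+1 == t.+1) = false by split; lia.
    rewrite /block s4Bag s4Dat s4Pos /upd ne1 ne2; split=> //; first exact: leq_trans le_pos.
    rewrite (_ : map _ _ = block s1 i) //; apply/eq_in_map => j.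
    by rewrite mem_index_iota => /andP[_ lt_j]; rewrite s3Keep // (leq_trans lt_j).
  have it' : i = t' by apply: ord_inj.
  rewrite /block s4Bag s4Dat s4Pos it /upd eqxx ltn_eqF // s1Bag; split=> //.
  rewrite s3Blk it'; apply: uniq_perm; first by rewrite filter_uniq ?iota_uniq.
    by rewrite (map_inj_uniq (@ord_inj n)) enum_uniq.
  move=> v; rewrite mem_filter mem_iota add0n leq0n /=.
  by apply/andP/idP => [[]|vE] //; split=> //; apply: ords_lt vE.
apply: (@runs_weaken _ _ (30 * n + 30 + ((m - 0) * (2000 * W + 1 + 6) + (1 + 1 + 4)))); last 1 first.
- by move=> s' _ H; exact: H.
- apply: runs_seq; apply: (runs_weaken (@runs_setup s n r m sN sR sM)) => // s0 fr0.
  case=> s0NN s0Lay s0Pos s0Lo s0Bag; have [frr0 fra0] := fr0.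
  have run : runs (For rT (Const 0) (Reg rM) step_code) s0
      ((m - 0) * (2000 * W + 1 + 6) + (1 + 1 + 4)) (I m).
    apply: (@runs_for _ _ _ _ I) => //.
    - by move=> s' [fr _]; rewrite /= fr // frr0.
    - split=> //.
      + by split=> //; rewrite -[LHS]/(arr s0 aBag 0) s0Bag /upd eqxx -s0Pos.
      + by move=> i lt_i; rewrite -[LHS]/(arr s0 aBag i) s0Bag /upd gtn_eqF.
      + split; first by rewrite -[leqRHS]/(reg s0 rPos) s0Pos.
        by move=> j _; rewrite -[LHS]/(arr s0 aDat j) fra0.
    - by move=> k s' /andP[_ lt_k] fr s'k Ik; apply: (step s0).
  apply: (runs_weaken run) => // s' [fr fa] [_ _ _ newP].
  split.
  - split; first by rewrite fr // frr0.
    by move=> t; rewrite !fa // !fra0.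
  - by move=> t; have [] := newP t (ltn_ord t).
  - by move=> v; rewrite fa // s0Lay // layP.
rewrite subn0 -/W.
have mW : m <= m * W by rewrite leq_pmulr.
(* As the tree has a node, the setup, linear in [n], also fits into the bound. *)
have WmW : W <= m * W by rewrite leq_pmull.
rewrite (_ : m * (2000 * W + 1 + 6) = 2000 * (m * W) + 7 * m); lia.
Qed.

Lemma tree_decomposition_gt0 n m (G : sgraph 'I_n) (T : sgraph 'I_m) X :
  tree_decomposition G T X -> 0 < m.
Proof. by case=> [[]]; rewrite card_ord. Qed.

(** The same program serves both statements, since the kind of width enters only through the witness
    for the output. The tree is returned unchanged, hence with [m] nodes. *)
Lemma main_code_computes n (G : sgraph 'I_n) (P : {set 'I_n}) r m (T : sgraph 'I_m) X lay s l :
  0 < m -> stores_instance s G P r -> stores_decomposition s T X lay ->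
  witness_layered_tin (cliquification r G P) T (enlarge G P r X) (coarsen r lay) l ->
  computes_layered_tin main_code s (3000 * (m * maxn 1 (n + #|edge_set G|)))
    (cliquification r G P) m l.
Proof.
move=> m_gt0 inst dec wit; have [c [s' [ex le_c dec']]] := runs_main m_gt0 inst dec.
by exists c, s', m, T, (enlarge G P r X), (coarsen r lay).
Qed.

Theorem theorem3p1 :
  (exists (prog : cmd) (C : nat),
    forall (n : nat) (G : sgraph 'I_n) (P : {set 'I_n}) (r m : nat)
           (T : sgraph 'I_m) (X : 'I_m -> {set 'I_n}) (lay : 'I_n -> nat)
           (k : nat) (s : state),
      0 < r ->
      witness_layered_tw G T X lay k ->
      stores_instance s G P r ->
      stores_decomposition s T X lay ->
      computes_layered_tin prog s (C * (m * maxn 1 (n + #|edge_set G|)))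
        (cliquification r G P) m (4 * r * k))
  /\
  (exists (prog : cmd) (C : nat),
    forall (n : nat) (G : sgraph 'I_n) (P : {set 'I_n}) (r m : nat)
           (T : sgraph 'I_m) (X : 'I_m -> {set 'I_n}) (lay : 'I_n -> nat)
           (k : nat) (s : state),
      r = 1 ->
      independent G P ->
      witness_layered_tin G T X lay k ->
      stores_instance s G P r ->
      stores_decomposition s T X lay ->
      computes_layered_tin prog s (C * (m * maxn 1 (n + #|edge_set G|)))
        (cliquification r G P) m (4 * r * k)).
Proof.
split; exists main_code, 3000 => n G P r m T X lay k s.
  move=> r_gt0 wit inst dec; have [decX _ _] := wit.
  exact: main_code_computes (tree_decomposition_gt0 decX) inst dec (witness_enlarge_tw P r_gt0 wit).
move=> r1 indP wit inst dec; have [decX _ _] := wit.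
exact: main_code_computes (tree_decomposition_gt0 decX) inst dec (witness_enlarge_tin r1 indP wit).
Qed.
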